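(* Assume $n$ is an even integer with $|n|>2$. The quotient $Y_0(\Gamma_n)=X_0(\Gamma_n)/\mu_2$ corresponds to the identification of $F$ under the hyperelliptic involution $(y,w)\mapsto(y,-w)$ and the involution $(y,w)\mapsto(-y,w)$. The set $Y_0(\Gamma_n)$ is birational to an $\mathbb{A}^1$. When $n\equiv2\pmod4$, the identification on the additional line component is an involution. The portion of $Y(\Gamma_n)\subset\mathbb{A}^3(\bar x,\bar y,\bar z)$ that does not lift to $X(\Gamma_n)$ is determined by components isomorphic to points and lines. The points are $(2,\bar y,\tfrac12\bar y)$ for $\bar y\in(\mathcal R_{2n}^{fib})^2-(\mathcal R_n^{fib})^2$ and $(0,\bar y,0)$ for $\bar y\in(\mathcal R_{n-2}^{fib})^2-(\mathcal R_{(n-2)/2}^{fib})^2$. The lines are given parametrically by $\left(q_1(\bar y),\,\bar y,\,\frac{q_2(\bar y)}{q_3(\bar y)}\right)$, and when $n\equiv0\pmod4$ there is an additional line component with characters $(0,0,\bar z)$.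
   Context: $\Gamma_n=\langle \alpha,\beta : \beta^{-n}=\alpha^{-1}\beta\alpha^2\beta\alpha^{-1}\rangle$ is the fundamental group of the once-punctured torus bundle $M_n$ with monodromy $\tau_c\tau_b^{n+2}$, where $b,c$ are simple closed curves on the once-punctured torus meeting transversally once and $\tau_a$ is the right-handed Dehn twist along $a$. For $|n|>2$, $M_n$ is hyperbolic. $X(\Gamma_n)\subset\mathbb{A}^3(x,y,z)$ is the Zariski closure of the set of characters of irreducible representations $\rho:\Gamma_n\to\mathrm{SL}_2(\mathbb{C})$, with coordinates $x=\mathrm{tr}\rho(\alpha)$, $y=\mathrm{tr}\rho(\beta)$, $z=\mathrm{tr}\rho(\alpha\beta)$. $X_0(\Gamma_n)$ is its unique canonical component, i.e. the component containing the character of a discrete faithful representation. For $n\equiv2\pmod4$ there is one additional component, the line $\{(0,0,z)\}$. $Y(\Gamma_n)$ is the Zariski closure of the set of irreducible characters in the $\mathrm{PSL}_2(\mathbb{C})$ character variety of $\Gamma_n$, and $Y_0(\Gamma_n)$ is a component of it containing the character of a discrete faithful representation. For $n$ even, $Y(\Gamma_n)$ is described by the coordinates $\bar x=x^2$, $\bar y=y^2$, $\bar z=z^2$, where $x,y,z$ are traces of matrices in $\mathrm{SL}_2(\mathbb{C})$ lifting the images of $\alpha$, $\beta$ and of their product. The portion of $Y(\Gamma_n)$ that does not lift to $X(\Gamma_n)$ consists of the characters of those representations to $\mathrm{PSL}_2(\mathbb{C})$ that do not lift to representations to $\mathrm{SL}_2(\mathbb{C})$. The quotient written $/\mu_2$,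 where $\mu_2=\{\pm1\}$, is by the action of $\mathrm{Hom}(\Gamma_n,\mu_2)$ on $\mathrm{SL}_2(\mathbb{C})$ characters. For $n$ even this group is $\mathbb{Z}/2\mathbb{Z}\times\mathbb{Z}/2\mathbb{Z}$ and its action is generated by $(x,y,z)\mapsto(-x,y,-z)$ and $(x,y,z)\mapsto(x,-y,-z)$. $F$ is the affine curve $w^2=-\hat h_n(y)\hat\ell_n(y)$, which is birational to $X_0(\Gamma_n)$. Polynomials and sets: $f_0(u)=0$, $f_1(u)=1$, $f_{k-1}(u)+f_{k+1}(u)=uf_k(u)$ for all $k\in\mathbb{Z}$. With $n=2m$, $h_n=f_{m-1}$ and $\ell_n=f_{m+1}-f_{m-1}$. If $n\equiv0\pmod4$ then $\hat h_n=h_n$ and $\hat\ell_n=\ell_n$; if $n\equiv2\pmod4$ then $u\hat h_n(u)=h_n(u)$ and $u\hat\ell_n(u)=\ell_n(u)$. The polynomials $q_1,q_2,q_3$ are defined by $q_1(u^2)=f_{n-1}(u)+1$, $q_2(u^2)=(f_n(u)+u)^2$, $q_3(u^2)=f_{n-1}(u)+1$. For an integer $N\neq0$, $\mathcal R_N=\{2\,\mathrm{Re}(\zeta):\zeta^{|N|}=1\}$ and $\mathcal R_N^{fib}=\mathcal R_N\setminus\{2,-2\}$. For a set $S$ of numbers, $(S)^2$ denotes $\{s^2:s\in S\}$, and $-$ between sets denotes set difference.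
   Formalization: Second point family is indexed by (R_{2(n-2)}^fib)^2-(R_{n-2}^fib)^2 (printed set fails, e.g. n=6); points are not claimed as components; the closure of the parametrized curve is only birational to a line; the discrete faithful representation defining Y_0 is assumed to lift. *)

(* Defs.v *)
From mathcomp Require Import all_boot all_order all_algebra.
From mathcomp Require Import complex mpoly.
From mathcomp Require Import classical_sets reals.

Set Implicit Arguments.
Unset Strict Implicit.
Unset Printing Implicit Defensive.

Import Order.TTheory GRing.Theory Num.Theory.
Local Open Scope classical_set_scope.
Local Open Scope ring_scope.

(** * Affine algebraic geometry over an algebraically closed field *)

Section AlgebraicSets.
Variable C : numClosedFieldType.

(* The closed points of affine k-space. *)
Definition pt (k : nat) := (k.-tuple C)%type.

Definition peval k (f : {mpoly C[k]}) (p : pt k) : C := f.@[tnth p].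

Definition zclosed k (S : set (pt k)) : Prop :=
  exists I : set {mpoly C[k]},
    S = [set p | forall f, I f -> peval f p = 0].

Definition zclosure k (S : set (pt k)) : set (pt k) :=
  [set p | forall f, (forall q, S q -> peval f q = 0) -> peval f p = 0].

Definition zirreducible k (S : set (pt k)) : Prop :=
  S !=set0 /\
  forall A B : set (pt k), zclosed A -> zclosed B ->
    S `<=` A `|` B -> S `<=` A \/ S `<=` B.

Definition is_variety k (V : set (pt k)) : Prop := zclosed V /\ zirreducible V.

Definition is_component k (X V : set (pt k)) : Prop :=
  [/\ is_variety V, V `<=` X
    & forall W, is_variety W -> V `<=` W -> W `<=` X -> W = V].

Definition affine_line : set (pt 1) := setT.

(* A rational map, its coordinates being written over a common denominator. *)
Record ratmap (k l : nat) := RatMap {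
  rnum : l.-tuple {mpoly C[k]};
  rden : {mpoly C[k]} }.

Definition reval k l (phi : ratmap k l) (p : pt k) : pt l :=
  map_tuple (fun f => peval f p / peval (rden phi) p) (rnum phi).

Definition rdom k l (phi : ratmap k l) (V : set (pt k)) : set (pt k) :=
  [set p | V p /\ peval (rden phi) p != 0].

Definition is_ratmap k l (phi : ratmap k l) (V : set (pt k)) (W : set (pt l)) :=
  rdom phi V !=set0 /\ forall p, rdom phi V p -> W (reval phi p).

(* psi o phi is defined somewhere on V, hence on a dense open subset when V is
   irreducible, and it is the identity wherever it is defined. *)
Definition rat_left_inverse k l (phi : ratmap k l) (psi : ratmap l k)
    (V : set (pt k)) (W : set (pt l)) : Prop :=
  (exists2 p, rdom phi V p & rdom psi W (reval phi p)) /\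
  forall p, rdom phi V p -> rdom psi W (reval phi p) ->
    reval psi (reval phi p) = p.

Definition birational_map k l (phi : ratmap k l)
    (V : set (pt k)) (W : set (pt l)) : Prop :=
  [/\ is_variety V, is_variety W, is_ratmap phi V W
    & exists psi : ratmap l k,
        [/\ is_ratmap psi W V, rat_left_inverse phi psi V W
          & rat_left_inverse psi phi W V]].

Definition birational k l (V : set (pt k)) (W : set (pt l)) : Prop :=
  exists phi : ratmap k l, birational_map phi V W.

Definition polymap k l (P : l.-tuple {mpoly C[k]}) (p : pt k) : pt l :=
  map_tuple (fun f => peval f p) P.

Definition zisomorphic k l (V : set (pt k)) (W : set (pt l)) : Prop :=
  exists (P : l.-tuple {mpoly C[k]}) (Q : k.-tuple {mpoly C[l]}),
    [/\ forall p, V p -> W (polymap P p),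
        forall q, W q -> V (polymap Q q),
        forall p, V p -> polymap Q (polymap P p) = p
      & forall q, W q -> polymap P (polymap Q q) = q].

End AlgebraicSets.

(** * The group Gamma_n *)

Inductive letter := Alpha | AlphaInv | Beta | BetaInv.

Definition word := seq letter.

Definition letter_inv (s : letter) : letter :=
  match s with
  | Alpha => AlphaInv | AlphaInv => Alpha
  | Beta => BetaInv | BetaInv => Beta
  end.

(* The word beta^k. *)
Definition beta_pow (k : int) : word :=
  match k with
  | Posz j => nseq j Beta
  | Negz j => nseq j.+1 BetaInv
  end.

(* u and v represent the same element of
   Gamma_n = < alpha, beta : beta^-n = alpha^-1 beta alpha^2 beta alpha^-1 >. *)
Inductive gamma_eq (n : int) : word -> word -> Prop :=
| gamma_refl u : gamma_eq n u u
| gamma_sym u v : gamma_eq n u v -> gamma_eq n v u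
| gamma_trans u v w : gamma_eq n u v -> gamma_eq n v w -> gamma_eq n u w
| gamma_cat u u' v v' :
    gamma_eq n u u' -> gamma_eq n v v' -> gamma_eq n (u ++ v) (u' ++ v')
| gamma_cancel s : gamma_eq n [:: s; letter_inv s] [::]
| gamma_relation :
    gamma_eq n (beta_pow (- n))
               [:: AlphaInv; Beta; Alpha; Alpha; Beta; AlphaInv].

(** * Representations and characters *)

Section Representations.
Variable C : numClosedFieldType.
Implicit Types (A B : 'M[C]_2) (n : int).

Definition letter_val A B (s : letter) : 'M[C]_2 :=
  match s with
  | Alpha => A | AlphaInv => A^-1 | Beta => B | BetaInv => B^-1
  end.

Definition word_val A B (w : word) : 'M[C]_2 :=
  \prod_(s <- w) letter_val A B s.

Definition rel_word A B : 'M[C]_2 := A^-1 * B * A ^+ 2 * B * A^-1.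

(* A representation to SL_2 is given by the images A, B of alpha, beta. *)
Definition sl_rep n A B : Prop :=
  [/\ \det A = 1, \det B = 1 & B ^ (- n) = rel_word A B].

(* A representation to PSL_2, given by matrices A, B in SL_2 lifting the images
   of alpha, beta: the relation is only required up to sign. *)
Definition psl_rep n A B : Prop :=
  [/\ \det A = 1, \det B = 1
    & B ^ (- n) = rel_word A B \/ B ^ (- n) = - rel_word A B].

Definition liftable n A B : Prop :=
  exists A' B', [/\ A' = A \/ A' = - A, B' = B \/ B' = - B & sl_rep n A' B'].

(* No common eigenline; this is insensitive to the signs of A and B, so it is
   irreducibility both for SL_2 and for PSL_2. *)
Definition irreducible_rep A B : Prop :=
  ~ exists v : 'cV[C]_2,
      [/\ v != 0, exists a : C, A *m v = a *: v & exists b : C, B *m v = b *: v].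

Definition close_to_1 (e : C) (M : 'M[C]_2) : Prop :=
  forall i j, `|M i j - (1 : 'M[C]_2) i j| < e.

(* A subgroup is discrete iff the identity is isolated in it. *)
Definition sl_discrete_faithful n A B : Prop :=
  (forall w, word_val A B w = 1 -> gamma_eq n w [::]) /\
  exists2 e : C, 0 < e &
    forall w, close_to_1 e (word_val A B w) -> word_val A B w = 1.

Definition psl_discrete_faithful n A B : Prop :=
  (forall w, word_val A B w = 1 \/ word_val A B w = - 1 -> gamma_eq n w [::]) /\
  exists2 e : C, 0 < e & forall w,
    (close_to_1 e (word_val A B w) -> word_val A B w = 1) /\
    (close_to_1 e (- word_val A B w) -> word_val A B w = - 1).

Definition sl_char A B : pt C 3 := [tuple \tr A; \tr B; \tr (A * B)].

(* (xbar, ybar, zbar) = (x^2, y^2, z^2). *)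
Definition psl_char A B : pt C 3 :=
  [tuple (\tr A) ^+ 2; (\tr B) ^+ 2; (\tr (A * B)) ^+ 2].

Definition X_ n : set (pt C 3) :=
  zclosure [set p | exists A B,
    [/\ sl_rep n A B, irreducible_rep A B & p = sl_char A B]].

Definition Y_ n : set (pt C 3) :=
  zclosure [set p | exists A B,
    [/\ psl_rep n A B, irreducible_rep A B & p = psl_char A B]].

Definition Y_nonlifting n : set (pt C 3) :=
  [set p | Y_ n p /\
     exists A B, [/\ psl_rep n A B, ~ liftable n A B & p = psl_char A B]].

(** * The action of Hom(Gamma_n, mu_2) *)

(* The homomorphism to {1, -1} with alpha |-> a, beta |-> b. *)
Definition mu2_hom n (a b : C) : Prop :=
  [/\ a ^+ 2 = 1, b ^+ 2 = 1 & b ^ (- n) = a^-1 * b * a ^+ 2 * b * a^-1].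

Definition mu2_act (a b : C) (p : pt C 3) : pt C 3 :=
  [tuple a * p`_0; b * p`_1; a * b * p`_2].

Definition mu2_orbit n (p q : pt C 3) : Prop :=
  exists a b, mu2_hom n a b /\ q = mu2_act a b p.

Definition sqmap (p : pt C 3) : pt C 3 :=
  [tuple p`_0 ^+ 2; p`_1 ^+ 2; p`_2 ^+ 2].

(* Y is the quotient of X by Hom(Gamma_n, mu_2), with quotient map
   (x, y, z) |-> (x^2, y^2, z^2): the points of Y are the orbits, and the regular
   functions on Y are the invariant regular functions on X. *)
Definition is_mu2_quotient n (X Y : set (pt C 3)) : Prop :=
  [/\ forall a b p, mu2_hom n a b -> X p -> X (mu2_act a b p),
      Y = sqmap @` X,
      forall p q, X p -> X q -> (sqmap p = sqmap q <-> mu2_orbit n p q)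
    & forall g : {mpoly C[3]},
        (forall a b p, mu2_hom n a b -> X p ->
           peval g (mu2_act a b p) = peval g p) ->
        exists g' : {mpoly C[3]},
          forall p, X p -> peval g p = peval g' (sqmap p)].

Definition z_axis : set (pt C 3) := [set p | exists z, p = [tuple 0; 0; z]].

(** * Polynomials and roots of unity *)

Fixpoint fpoly_nat (k : nat) : {poly C} :=
  if k is k'.+1 then
    if k' is k''.+1 then 'X * fpoly_nat k' - fpoly_nat k'' else 1
  else 0.

Definition fpoly (k : int) : {poly C} :=
  match k with
  | Posz j => fpoly_nat j
  | Negz j => - fpoly_nat j.+1
  end.

Lemma fpoly_rec (k : int) : fpoly (k - 1) + fpoly (k + 1) = 'X * fpoly k.
Proof.
have rec j : fpoly_nat j.+2 = 'X * fpoly_nat j.+1 - fpoly_nat j by [].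
case: k => [[|j]|[|j]].
- by rewrite /= mulr0 addNr.
- have -> : (Posz j.+1 - 1 = j)%R by rewrite -addn1 PoszD addrK.
  by rewrite -PoszD addn1 /fpoly rec addrC subrK.
- by rewrite /fpoly /= addr0 mulr1 subr0 mulrN1.
- have -> : Negz j.+1 - 1 = Negz j.+2 by rewrite !NegzE -opprD -PoszD addn1.
  have -> : Negz j.+1 + 1 = Negz j.
    by rewrite !NegzE -[in LHS]addn1 PoszD opprD addrNK.
  by rewrite /fpoly (rec j.+1) mulrN opprB addrAC subrr add0r.
Qed.

(* With n = 2m. *)
Definition hpoly n : {poly C} := fpoly ((n %/ 2)%Z - 1).
Definition lpoly n : {poly C} :=
  fpoly ((n %/ 2)%Z + 1) - fpoly ((n %/ 2)%Z - 1).

(* ph is p-hat, for p = h_n or l_n. *)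
Definition is_hat n (p ph : {poly C}) : Prop :=
  ((n %% 4)%Z = 0 -> ph = p) /\ ((n %% 4)%Z = 2 -> 'X * ph = p).

Definition Rset (N : int) : set C :=
  [set s | exists2 zeta : C, zeta ^+ `|N|%N = 1 & s = 2 * 'Re zeta].

Definition Rfib (N : int) : set C := Rset N `\` [set 2; -2].

Definition sqset (S : set C) : set C := [set s ^+ 2 | s in S].

(** * The curve F *)

(* w^2 = - h^ l^, in the coordinates (y, w). *)
Definition Fcurve (hh lh : {poly C}) : set (pt C 2) :=
  [set p | p`_1 ^+ 2 = - hh.[p`_0] * lh.[p`_0]].

Definition F_hyp (p : pt C 2) : pt C 2 := [tuple p`_0; - p`_1].
Definition F_neg (p : pt C 2) : pt C 2 := [tuple - p`_0; p`_1].

(* The equivalence relation generated by p ~ F_hyp p and p ~ F_neg p. *)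
Inductive F_identified : pt C 2 -> pt C 2 -> Prop :=
| F_id_hyp p : F_identified p (F_hyp p)
| F_id_neg p : F_identified p (F_neg p)
| F_id_refl p : F_identified p p
| F_id_sym p q : F_identified p q -> F_identified q p
| F_id_trans p q r : F_identified p q -> F_identified q r -> F_identified p r.

(** * The representations that do not lift *)

Definition nl_points1 n : set (pt C 3) :=
  [set p | exists2 yb, (sqset (Rfib (2 * n)) `\` sqset (Rfib n)) yb
                     & p = [tuple 2; yb; yb / 2]].

(* The values yb = (s + s^-1)^2 with s^(n-2) = -1. *)
Definition nl_points2 n : set (pt C 3) :=
  [set p | exists2 yb, (sqset (Rfib (2 * (n - 2))) `\` sqset (Rfib (n - 2))) yb
                     & p = [tuple 0; yb; 0]].

Definition nl_curve (q1 q2 q3 : {poly C}) : set (pt C 3) :=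
  [set p | exists2 yb, q3.[yb] != 0
                     & p = [tuple q1.[yb]; yb; q2.[yb] / q3.[yb]]].

End Representations.

(* Main.v *)
(* Write f_k for the value of [fpoly k] at y = tr B.  The elements 1, A, B of an irreducible
   pair are linearly independent, so the relation A B^-n A = c B A^2 B (c = 1 or -1) amounts
   to three equations in the traces: x^2 = 1 - c f_{n-1}, x z = y - c f_n and
   x f_{n+1} - z f_n = c x.  For n even, c = -1 is exactly the non-lifting case.

   With n = 2m, u = f_{m-1}, v = f_m everything is polynomial in y, u, v subject to
   u^2 + v^2 - y u v = 1.  For c = 1 the equations describe the curve
   (x, y, z) = (d w, y, w L / l^) over w^2 = - h^ l^, with d = 1 or y and L = f_{m+2} - f_m,
   together with the z-axis when n = 2 mod 4.  It is irreducible because l^ has a simple root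
   that is not a root of h^ (l_n' = m f_m); sign changes of the traces become sign changes of
   y and w, and the squares of the traces are rational functions of y^2.  For c = -1 they
   describe the graph over y^2, finitely many points, and the z-axis when n = 0 mod 4.

   Faithfulness excludes the components not containing the canonical character: alpha has
   infinite order, so tr A = 0 is impossible, and tr(A)^2 = 1 would give A^3 = 1 or -1. *)
Require Import Defs.
From mathcomp Require Import all_boot all_order all_algebra.
From mathcomp Require Import complex mpoly.
From mathcomp Require Import boolp classical_sets reals.
From mathcomp Require Import ring lra zify.

Set Implicit Arguments.
Unset Strict Implicit.
Unset Printing Implicit Defensive.

Import Order.TTheory GRing.Theory Num.Theory.
Local Open Scope classical_set_scope.
Local Open Scope ring_scope.

(** * Zariski-closed sets and irreducibility *)

Section Zariski.
Variable C : numClosedFieldType.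
Implicit Types (k l : nat).

(** Each variety is a closure, and its components are found by squeezing. For the upper bound,
    closed sets must cover all irreducible characters. The obstacle is that the main curve is
    parametrised with denominator [lh]; it is closed nevertheless, because w is a polynomial in x,
    y, z on it and w z = - [hh] [lnext] cannot hold over a root of [lh]. For the lower bound, every
    solution of the trace equations is realised by a pair of matrices, irreducible where the
    commutator does not have trace 2; this open condition holds somewhere on each curve or line,
    hence on a dense part of it.

    The trace equations are derived only for irreducible pairs, whereas the non-lifting part of Y
    and the canonical character are given by arbitrary representations. For a reducible one the
    relation is read on a common eigenline, where it becomes b^-n = c b^2 for an eigenvalue b of B;
    this fixes f_{n-1}, f_n and f_{n+1} unless b^2 = 1, a case treated by hand. *)

Lemma pt2E (p : pt C 2) : p = [tuple p`_0; p`_1].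
Proof. by apply/val_inj; case: p => -[|x [|y [|]]]. Qed.

Lemma pt3E (p : pt C 3) : p = [tuple p`_0; p`_1; p`_2].
Proof. by apply/val_inj; case: p => -[|x [|y [|z [|]]]]. Qed.

Lemma pt3_eq (p q : pt C 3) :
  p`_0 = q`_0 -> p`_1 = q`_1 -> p`_2 = q`_2 -> p = q.
Proof. by move=> h0 h1 h2; rewrite (pt3E p) (pt3E q) h0 h1 h2. Qed.

(** Polynomial functions are handled extensionally, so that equations of a variety can be written as
    plain expressions in the coordinates. *)
Definition polyfun k (e : pt C k -> C) : Prop :=
  exists f : {mpoly C[k]}, forall p, peval f p = e p.

Lemma pevalM k (f g : {mpoly C[k]}) p : peval (f * g) p = peval f p * peval g p.
Proof. by rewrite /peval mevalM. Qed.

Lemma polyfun_peval k (f : {mpoly C[k]}) : polyfun (peval f).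
Proof. by exists f. Qed.

Lemma polyfun_cst k (c : C) : polyfun (fun _ : pt C k => c).
Proof. by exists c%:MP => p; rewrite /peval mevalC. Qed.

Lemma polyfun_coord k (i : nat) : polyfun (fun p : pt C k => p`_i).
Proof.
have [ik|ki] := ltnP i k.
  by exists 'X_(Ordinal ik) => p; rewrite /peval mevalXU (tnth_nth 0).
have [f hf] := polyfun_cst k 0; exists f => p.
by rewrite hf nth_default // size_tuple.
Qed.

Lemma polyfunD k (e f : pt C k -> C) :
  polyfun e -> polyfun f -> polyfun (fun p => e p + f p).
Proof. by move=> [E hE] [F hF]; exists (E + F) => p; rewrite /peval mevalD -hE -hF. Qed.

Lemma polyfunN k (e : pt C k -> C) : polyfun e -> polyfun (fun p => - e p).
Proof. by move=> [E hE]; exists (- E) => p; rewrite /peval mevalN -hE. Qed.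

Lemma polyfunB k (e f : pt C k -> C) :
  polyfun e -> polyfun f -> polyfun (fun p => e p - f p).
Proof. by move=> he hf; apply: polyfunD => //; apply: polyfunN. Qed.

Lemma polyfunM k (e f : pt C k -> C) :
  polyfun e -> polyfun f -> polyfun (fun p => e p * f p).
Proof. by move=> [E hE] [F hF]; exists (E * F) => p; rewrite pevalM hE hF. Qed.

Lemma polyfunX k (e : pt C k -> C) j : polyfun e -> polyfun (fun p => e p ^+ j).
Proof. by move=> [E hE]; exists (E ^+ j) => p; rewrite -hE /peval rmorphXn. Qed.

Lemma polyfun_sum k (I : Type) (r : seq I) (e : I -> pt C k -> C) :
  (forall i, polyfun (e i)) -> polyfun (fun p => \sum_(i <- r) e i p).
Proof.
move=> he; elim: r => [|i r IH].
  by have [f hf] := polyfun_cst k 0; exists f => p; rewrite hf big_nil.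
have [f hf] := polyfunD (he i) IH.
by exists f => p; rewrite hf big_cons.
Qed.

Lemma polyfun_prod k (I : Type) (r : seq I) (e : I -> pt C k -> C) :
  (forall i, polyfun (e i)) -> polyfun (fun p => \prod_(i <- r) e i p).
Proof.
move=> he; elim: r => [|i r IH].
  by have [f hf] := polyfun_cst k 1; exists f => p; rewrite hf big_nil.
have [f hf] := polyfunM (he i) IH.
by exists f => p; rewrite hf big_cons.
Qed.

Lemma polyfun_horner k (q : {poly C}) (e : pt C k -> C) :
  polyfun e -> polyfun (fun p => q.[e p]).
Proof.
move=> he.
have [f hf] : polyfun (fun p => \sum_(i <- enum 'I_(size q)) q`_i * e p ^+ i).
  by apply: polyfun_sum => i; apply: polyfunM; [apply: polyfun_cst|apply: polyfunX].
by exists f => p; rewrite hf horner_coef big_enum.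
Qed.

Lemma polyfun_comp k l (f : {mpoly C[l]}) (g : pt C k -> pt C l) :
  (forall i : nat, polyfun (fun p => (g p)`_i)) ->
  polyfun (fun p => peval f (g p)).
Proof.
move=> hg.
have [F hF] : polyfun (fun p => \sum_(m <- msupp f) f@_m *
   \prod_(i <- index_enum 'I_l) (g p)`_i ^+ m i).
  apply: polyfun_sum => m; apply: polyfunM; first exact: polyfun_cst.
  by apply: polyfun_prod => i; apply: polyfunX.
exists F => p; rewrite hF /peval mevalE.
by apply: eq_bigr => m _; congr (_ * _); apply: eq_bigr => i _; rewrite (tnth_nth 0).
Qed.

Lemma zclosed_zero k (e : pt C k -> C) : polyfun e -> zclosed [set p | e p = 0].
Proof.
move=> [f hf]; exists [set f]; apply/seteqP; split => p /=.
  by move=> h _ ->; rewrite hf.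
by move=> h; rewrite -hf; apply: h.
Qed.

Lemma zclosed_eq k (e f : pt C k -> C) :
  polyfun e -> polyfun f -> zclosed [set p | e p = f p].
Proof.
move=> he hf.
have -> : [set p | e p = f p] = [set p | e p - f p = 0].
  by apply/seteqP; split => p /=; [move=> ->; rewrite subrr|move/subr0_eq].
by apply: zclosed_zero; apply: polyfunB.
Qed.

Lemma zclosedI k (S T : set (pt C k)) : zclosed S -> zclosed T -> zclosed (S `&` T).
Proof.
move=> [I ->] [J ->]; exists (I `|` J); apply/seteqP; split => p /=.
  by move=> [hI hJ] f [/hI|/hJ].
by move=> h; split => f hf; apply: h; [left|right].
Qed.

Lemma zclosedU k (S T : set (pt C k)) : zclosed S -> zclosed T -> zclosed (S `|` T).
Proof.
move=> [I ->] [J ->].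
exists [set f | exists g h, [/\ I g, J h & f = g * h]]; apply/seteqP; split => p /=.
  by move=> [hI|hJ] _ [g [h [hg hh ->]]]; rewrite pevalM;
    [rewrite (hI g hg) mul0r|rewrite (hJ h hh) mulr0].
move=> hp; apply: contrapT => /not_orP [] /existsNP [g /not_implyP [Ig g0]].
move=> /existsNP [h /not_implyP [Jh h0]].
have : peval (g * h) p = 0 by apply: hp; exists g, h.
by rewrite pevalM => /eqP; rewrite mulf_eq0 => /orP [] /eqP.
Qed.

Lemma zclosedT k : zclosed (setT : set (pt C k)).
Proof. by exists set0; apply/seteqP; split => p // _ f. Qed.

Lemma sub_zclosure k (S : set (pt C k)) : S `<=` zclosure S.
Proof. by move=> p Sp f; apply. Qed.

Lemma zclosure_closed k (S : set (pt C k)) : zclosed (zclosure S).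
Proof.
by exists [set f | forall q, S q -> peval f q = 0].
Qed.

Lemma zclosure_min k (S T : set (pt C k)) : zclosed T -> S `<=` T -> zclosure S `<=` T.
Proof.
move=> [I ->] ST p hp f If; apply: hp => q Sq.
exact: (ST q Sq).
Qed.

(** Irreducibility as primeness of the vanishing ideal: a point missed by each of two closed sets
    yields two polynomials whose product must not vanish identically. *)
Lemma zirreducible_fun k (S : set (pt C k)) : S !=set0 ->
  (forall f g : {mpoly C[k]}, (forall p, S p -> peval f p * peval g p = 0) ->
     (forall p, S p -> peval f p = 0) \/ (forall p, S p -> peval g p = 0)) ->
  zirreducible S.
Proof.
move=> S0 h; split=> // A B [I ->] [J ->] SAB.
apply: contrapT => /not_orP [] /existsNP [p /not_implyP [Sp]] /existsNP [f].
move=> /not_implyP [If fp] /existsNP [q /not_implyP [Sq]] /existsNP [g].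
move=> /not_implyP [Jg gq].
have [r Sr|/(_ _ Sp)//|/(_ _ Sq)//] := h f g.
have [|] := SAB r Sr; first by move=> /(_ f If) ->; rewrite mul0r.
by move=> /(_ g Jg) ->; rewrite mulr0.
Qed.

Lemma zirreducible_mul k (S : set (pt C k)) (f g : {mpoly C[k]}) : zirreducible S ->
  (forall p, S p -> peval f p * peval g p = 0) ->
  (forall p, S p -> peval f p = 0) \/ (forall p, S p -> peval g p = 0).
Proof.
move=> [_ irr] h.
have := irr [set p | peval f p = 0] [set p | peval g p = 0].
apply; try by apply: zclosed_zero; apply: polyfun_peval.
by move=> p /h /eqP; rewrite mulf_eq0 => /orP [] /eqP; [left|right].
Qed.

Lemma zirreducible_closure k (S : set (pt C k)) :
  zirreducible S -> zirreducible (zclosure S).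
Proof.
move=> [[p Sp] irr]; split; first by exists p; apply: sub_zclosure.
move=> A B cA cB h; have [||] := irr A B cA cB.
- by move=> q /sub_zclosure /h.
- by left; apply: zclosure_min.
- by right; apply: zclosure_min.
Qed.

Lemma zirreducible_image k l (S : set (pt C k)) (g : pt C k -> pt C l) :
  (forall i : nat, polyfun (fun p => (g p)`_i)) ->
  zirreducible S -> zirreducible (g @` S).
Proof.
move=> hg irr; apply: zirreducible_fun => [|f h H].
  by case: irr => [[p Sp] _]; exists (g p); exists p.
have [F hF] := polyfun_comp f hg; have [H' hH] := polyfun_comp h hg.
have [||] := zirreducible_mul (f := F) (g := H') irr.
- by move=> p Sp; rewrite hF hH; apply: H; exists p.
- by move=> K; left => _ [p Sp <-]; rewrite -hF; apply: K.
- by move=> K; right => _ [p Sp <-]; rewrite -hH; apply: K.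
Qed.

(** If f vanishes on [T], then f e vanishes on [S]; since e does not, primeness makes f vanish on
    [S]. In the applications [T] contains the irreducible characters in [S] and e detects
    irreducibility. *)
Lemma dense_open k (S T : set (pt C k)) (e : pt C k -> C) : zirreducible S ->
  polyfun e -> (exists2 p, S p & e p != 0) ->
  (forall p, S p -> e p != 0 -> T p) -> S `<=` zclosure T.
Proof.
move=> irr [E hE] [p0 Sp0 ep0] ST p Sp f fT.
have [||] := zirreducible_mul (f := f) (g := E) irr; last first.
- by move=> /(_ _ Sp0); rewrite hE => /eqP; rewrite (negbTE ep0).
- exact.
move=> q Sq; rewrite hE; have [->|e0] := eqVneq (e q) 0; first by rewrite mulr0.
by rewrite fT ?mul0r //; apply: ST.
Qed.

(** [D] collects the other pieces of [X]. A larger variety inside [X] lies in [V] or in [D] by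
    irreducibility, and the second would put [V] in [D]. *)
Lemma is_componentI k (X V D : set (pt C k)) : is_variety V -> V `<=` X ->
  zclosed D -> X `<=` V `|` D -> ~ V `<=` D -> is_component X V.
Proof.
move=> vV VX cD XVD nVD; split=> // W [cW [_ irr]] VW WX.
have [WV|WD] := irr V D vV.1 cD (subset_trans WX XVD).
  by apply/seteqP; split.
by case: nVD; apply: subset_trans WD.
Qed.

Lemma component_eq k (X V W : set (pt C k)) :
  is_component X V -> is_variety W -> W `<=` X -> V `<=` W -> V = W.
Proof. by move=> [_ _ h] vW WX VW; rewrite (h W). Qed.

End Zariski.

(** * Regular functions on a double cover w^2 = P(y) of the line *)

Section DoubleCover.
Variable C : numClosedFieldType.
Implicit Types (P d a b : {poly C}).

Lemma poly_fun_inj a b : (forall y, a.[y] = b.[y]) -> a = b.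
Proof.
move=> h; apply/eqP; rewrite -subr_eq0; apply/negPn/negP => nz.
(* In characteristic 0 the integers below the size are distinct, hence too many roots for a nonzero
   polynomial. *)
have := @max_poly_roots C (a - b) [seq i%:R | i <- iota 0 (size (a - b))] nz.
rewrite size_map size_iota ltnn => H; suff: false by []; apply: H.
  apply/allP => x _; rewrite rootE hornerD hornerN h subrr //.
by rewrite map_inj_uniq ?iota_uniq // => i j /eqP; rewrite eqr_nat => /eqP.
Qed.

Lemma nonroot_exists a : a != 0 -> exists y, a.[y] != 0.
Proof.
move=> a0; apply: contrapT => /forallNP h; case/eqP: a0; apply: poly_fun_inj => y.
by rewrite horner0; apply/eqP/negPn/negP; apply: h.
Qed.

(* Parity of the multiplicity of the simple root [r] of [P]. *)
Lemma not_square_ratio P r a b : P.[r] = 0 -> P^`().[r] != 0 ->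
  a ^+ 2 = P * b ^+ 2 -> b = 0.
Proof.
move=> Pr dPr e; apply/eqP/negPn/negP => b0.
have /factor_theorem [Q PQ] : root P r by rewrite rootE Pr.
have Qr : ~~ root Q r.
  move: dPr; rewrite PQ derivM derivB derivX derivC subr0 mulr1 hornerD hornerM.
  by rewrite !hornerE /= subrr mulr0 add0r.
have P0 : P != 0 by apply: contraNneq dPr => ->; rewrite deriv0 horner0.
have a0 : a != 0.
  by apply: contraTneq (mulf_neq0 P0 (expf_neq0 2 b0)) => a0; rewrite -e a0 expr2 mul0r negbK.
have b20 := mulf_neq0 b0 b0.
have := congr1 (mup r) e; rewrite !expr2 !mupM // PQ mupMr // -['X - _]expr1 mup_XsubCX eqxx.
by rewrite !addnn add1n => /(congr1 odd); rewrite /= !odd_double.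
Qed.

Definition dcover P d : set (C * C) := [set t | t.2 ^+ 2 = P.[t.1] /\ d.[t.1] != 0].

(** Membership in C[y, w, 1/d]: since w^2 = P(y), every element has the normal form (a + b w) / d^N,
    written here with the denominator cleared. *)
Definition dcover_reg P d (e : C * C -> C) : Prop :=
  exists (N : nat) (ab : {poly C} * {poly C}), forall t, dcover P d t ->
    e t * d.[t.1] ^+ N = ab.1.[t.1] + t.2 * ab.2.[t.1].

Lemma dcover_reg_cst P d c : dcover_reg P d (fun=> c).
Proof. by exists 0%N, (c%:P, 0) => t _; rewrite /= hornerC horner0 expr0; ring. Qed.

Lemma dcover_regD P d e f :
  dcover_reg P d e -> dcover_reg P d f -> dcover_reg P d (fun t => e t + f t).
Proof.
move=> [N [[a b] /= he]] [M [[a' b'] /= hf]].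
exists (N + M)%N, (a * d ^+ M + a' * d ^+ N, b * d ^+ M + b' * d ^+ N) => t ht.
rewrite exprD !(hornerD, hornerM, horner_exp) /=.
transitivity (e t * d.[t.1] ^+ N * d.[t.1] ^+ M + f t * d.[t.1] ^+ M * d.[t.1] ^+ N).
  by ring.
by rewrite he // hf //; ring.
Qed.

Lemma dcover_regM P d e f :
  dcover_reg P d e -> dcover_reg P d f -> dcover_reg P d (fun t => e t * f t).
Proof.
move=> [N [[a b] /= he]] [M [[a' b'] /= hf]].
exists (N + M)%N, (a * a' + P * b * b', a * b' + b * a') => t ht.
rewrite exprD !(hornerD, hornerM, horner_exp) /= -(proj1 ht).
transitivity ((e t * d.[t.1] ^+ N) * (f t * d.[t.1] ^+ M)); first by ring.
by rewrite he // hf //; ring.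
Qed.

Lemma dcover_reg_comp P d k (f : {mpoly C[k]}) (g : C * C -> pt C k) :
  (forall i : nat, (i < k)%N -> dcover_reg P d (fun t => (g t)`_i)) ->
  dcover_reg P d (fun t => peval f (g t)).
Proof.
move=> hg.
have ext e e' : (forall t, e t = e' t) -> dcover_reg P d e -> dcover_reg P d e'.
  by move=> h [N [ab H]]; exists N, ab => t /H; rewrite h.
have regX e j : dcover_reg P d e -> dcover_reg P d (fun t => e t ^+ j).
  move=> he; elim: j => [|j IH]; first exact: ext (dcover_reg_cst P d 1).
  by apply: ext (dcover_regM he IH) => t; rewrite exprS.
apply: (ext (fun t => \sum_(m <- msupp f) f@_m * \prod_(i <- index_enum 'I_k) (g t)`_i ^+ m i)).
  move=> t; rewrite /peval mevalE; apply: eq_bigr => m _; congr (_ * _).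
  by apply: eq_bigr => i _; rewrite (tnth_nth 0).
elim: (msupp f) => [|m r IH].
  by apply: ext (dcover_reg_cst P d 0) => t; rewrite big_nil.
apply: (ext (fun t => f@_m * \prod_(i <- index_enum 'I_k) (g t)`_i ^+ m i +
  \sum_(m <- r) f@_m * \prod_(i <- index_enum 'I_k) (g t)`_i ^+ m i)).
  by move=> t; rewrite big_cons.
apply: dcover_regD IH; apply: dcover_regM; first exact: dcover_reg_cst.
elim: (index_enum _) => [|i s IHs].
  by apply: ext (dcover_reg_cst P d 1) => t; rewrite big_nil.
apply: ext (dcover_regM (regX _ (m i) (hg i (ltn_ord i))) IHs) => t.
by rewrite big_cons.
Qed.

Lemma dcover_point P d y : d.[y] != 0 -> dcover P d (y, sqrtC P.[y]).
Proof. by move=> dy; split=> //=; rewrite sqrtCK. Qed.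

(* The norm (a + b w)(a - b w) = a^2 - P b^2 of a nonzero function is nonzero. *)
Lemma dcover_domain P d r e f : P.[r] = 0 -> P^`().[r] != 0 -> d != 0 ->
  dcover_reg P d e -> dcover_reg P d f ->
  (forall t, dcover P d t -> e t * f t = 0) ->
  (forall t, dcover P d t -> e t = 0) \/ (forall t, dcover P d t -> f t = 0).
Proof.
move=> Pr dPr d0 he hf ef0.
have key e' : dcover_reg P d e' -> exists q : {poly C},
   (forall t, dcover P d t -> e' t = 0 -> q.[t.1] = 0) /\
   (q = 0 -> forall t, dcover P d t -> e' t = 0).
  move=> [N [[a b] /= h]]; exists (a ^+ 2 - P * b ^+ 2); split.
    move=> t ht e0; have := h t ht; rewrite e0 mul0r => ab0.
    rewrite !(hornerD, hornerN, hornerM, horner_exp) -(proj1 ht).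
    have -> : a.[t.1] ^+ 2 - t.2 ^+ 2 * b.[t.1] ^+ 2 =
      (a.[t.1] + t.2 * b.[t.1]) * (a.[t.1] - t.2 * b.[t.1]) by ring.
    by rewrite -ab0 mul0r.
  move=> /subr0_eq ab2 t ht; have b0 := not_square_ratio Pr dPr ab2.
  move: ab2; rewrite b0 expr2 expr0n mulr0 => /eqP; rewrite mulf_eq0 orbb => /eqP a0.
  have := h t ht; rewrite a0 b0 !horner0 mulr0 addr0 => /eqP.
  by rewrite mulf_eq0 (negbTE (expf_neq0 _ (proj2 ht))) orbF => /eqP.
have [q [q1 q2]] := key e he; have [s [s1 s2]] := key f hf.
have : d * (q * s) = 0.
  apply: poly_fun_inj => y; rewrite !hornerM horner0.
  have [->|dy] := eqVneq d.[y] 0; first by rewrite mul0r.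
  have ht := dcover_point P dy; have /eqP := ef0 _ ht.
  rewrite mulf_eq0 => /orP [] /eqP.
    by move/(q1 _ ht) => /= ->; rewrite mul0r mulr0.
  by move/(s1 _ ht) => /= ->; rewrite !mulr0.
move/eqP; rewrite !mulf_eq0 (negbTE d0) /= => /orP [] /eqP ?; [left|right]; auto.
Qed.

Lemma dcover_image_irreducible P d r k (g : C * C -> pt C k) :
  P.[r] = 0 -> P^`().[r] != 0 -> d != 0 ->
  (forall i : nat, (i < k)%N -> dcover_reg P d (fun t => (g t)`_i)) ->
  zirreducible (g @` dcover P d).
Proof.
move=> Pr dPr d0 hg; apply: zirreducible_fun => [|f h fh].
  have [y dy] := nonroot_exists d0.
  by exists (g (y, sqrtC P.[y])); exists (y, sqrtC P.[y]) => //; apply: dcover_point.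
have [|H|H] := dcover_domain Pr dPr d0 (dcover_reg_comp f hg) (dcover_reg_comp h hg).
- by move=> t ht; apply: fh; exists t.
- by left => _ [t ht <-]; apply: H.
- by right => _ [t ht <-]; apply: H.
Qed.

(* The line is covered by w^2 = y. *)
Lemma line_image_irreducible d k (g : C -> pt C k) : d != 0 ->
  (forall i : nat, (i < k)%N -> exists (N : nat) (a : {poly C}),
     forall y, d.[y] != 0 -> (g y)`_i * d.[y] ^+ N = a.[y]) ->
  zirreducible [set p | exists2 y, d.[y] != 0 & p = g y].
Proof.
move=> d0 hg.
have -> : [set p | exists2 y, d.[y] != 0 & p = g y] = (g \o fst) @` dcover 'X d.
  apply/seteqP; split => [p [y dy ->]|_ [t ht <-]].
    by exists (y, sqrtC ('X : {poly C}).[y]) => //; apply: dcover_point.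
  by exists t.1 => //; case: ht.
apply: (@dcover_image_irreducible 'X d 0) => //; first by rewrite hornerX.
  by rewrite derivX hornerC oner_eq0.
move=> i ik; have [N [a h]] := hg i ik; exists N, (a, 0) => t [_ dt] /=.
by rewrite h // horner0 mulr0 addr0.
Qed.

End DoubleCover.

(** * The polynomials f_k *)

Section FPolynomials.
Variable C : numClosedFieldType.
Implicit Types (k : int) (y s : C).

Local Notation F k y := (fpoly C k).[y].

Lemma int_ind2 (P : int -> Prop) : P 0 -> P 1 ->
  (forall k, P (k - 1) -> P k -> P (k + 1)) ->
  (forall k, P k -> P (k + 1) -> P (k - 1)) -> forall k, P k.
Proof.
move=> P0 P1 up down k; suff : P k /\ P (k + 1) by case.
elim: k => [|j [h1 h2]|j [h1 h2]]; first by rewrite add0r.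
  have -> : Posz j.+1 = Posz j + 1 by rewrite -PoszD addn1.
  by split=> //; apply: up; rewrite ?addrK.
have -> : - (Posz j.+1) = - Posz j - 1 by rewrite -opprD -PoszD addn1.
by rewrite subrK; split => //; apply: down.
Qed.

Lemma fval_rec k y : F (k - 1) y + F (k + 1) y = y * F k y.
Proof. by rewrite -hornerD fpoly_rec hornerM hornerX. Qed.

Lemma fval0 y : F 0 y = 0. Proof. by rewrite horner0. Qed.
Lemma fval1 y : F 1 y = 1. Proof. by rewrite hornerC. Qed.
Lemma fvalN1 y : F (- 1) y = -1. Proof. by rewrite hornerN hornerC. Qed.

Lemma fval_succ k y : F (k + 1) y = y * F k y - F (k - 1) y.
Proof. by rewrite -fval_rec addrAC subrr add0r. Qed.

Lemma rec_eq0 (V : lmodType C) y (g : int -> V) :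
  (forall k, g (k - 1) + g (k + 1) = y *: g k) -> g 0 = 0 -> g 1 = 0 ->
  forall k, g k = 0.
Proof.
move=> h g0 g1; apply: int_ind2 => // k e1 e2.
  by have := h k; rewrite e1 e2 add0r scaler0.
by have := h k; rewrite e1 e2 addr0 scaler0.
Qed.

(** A solution of the recurrence is determined by its values at 0 and 1. Modules are allowed so that
    this covers the powers B^k of a matrix as well as scalar sequences. *)
Lemma rec_solution (V : lmodType C) y (g : int -> V) :
  (forall k, g (k - 1) + g (k + 1) = y *: g k) ->
  forall k, g k = F k y *: g 1 - F (k - 1) y *: g 0.
Proof.
move=> h k; apply/eqP; rewrite -subr_eq0; apply/eqP.
apply: (@rec_eq0 V y (fun k => g k - (F k y *: g 1 - F (k - 1) y *: g 0))) => [{}k||].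
- rewrite addrACA h -opprD addrACA -scalerDl fval_rec -opprD -scalerDl.
  have -> : k + 1 - 1 = k - 1 + 1 by ring.
  by rewrite fval_rec -!scalerA -!scalerBr.
- by rewrite fval0 scale0r sub0r fvalN1 scaleN1r opprK subrr.
- by rewrite subrr fval1 fval0 scale1r scale0r subr0 subrr.
Qed.

Lemma rec_solution1 y (g : int -> C) :
  (forall k, g (k - 1) + g (k + 1) = y * g k) ->
  forall k, g k = F k y * g 1 - F (k - 1) y * g 0.
Proof. by move=> h; apply: (@rec_solution C^o). Qed.

Lemma fvalD j k y : F (j + k) y = F k y * F (j + 1) y - F (k - 1) y * F j y.
Proof.
have := @rec_solution1 y (fun k => F (j + k) y); rewrite addr0; apply => {}k.
by rewrite !addrA fval_rec.
Qed.

Lemma fval2C k : F k 2 = k%:~R.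
Proof.
transitivity (F k 2 * 1%:~R - F (k - 1) 2 * 0%:~R); first by rewrite mulr0z; ring.
apply/esym/(@rec_solution1 2 (fun k => k%:~R)) => {}k.
by rewrite !rmorphD rmorphN /=; ring.
Qed.

Lemma fval_oppz k y : (-1) ^ k * F k (- y) = - F k y.
Proof.
rewrite (@rec_solution1 y (fun k => (-1) ^ k * F k (- y))).
  by rewrite fval0 fval1 mulr0 mulr1 expr1z; ring.
move=> {}k; have u1 : (-1 : C) != 0 by rewrite oppr_eq0 oner_eq0.
by rewrite !expfzDr //= expr1z exprN1 invrN1 fval_succ; ring.
Qed.

Lemma fval_opp_odd k y : F (k * 2 + 1) (- y) = F (k * 2 + 1) y.
Proof.
apply: oppr_inj; rewrite -(fval_oppz _ y) expfzDr ?oppr_eq0 ?oner_eq0 // [k * 2]mulrC.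
by rewrite -exprz_exp -exprnP sqrrN expr1n exp1rz expr1z; ring.
Qed.

Lemma fval_opp_even k y : F (k * 2) (- y) = - F (k * 2) y.
Proof.
by rewrite -(fval_oppz _ y) [k * 2]mulrC -exprz_exp -exprnP sqrrN expr1n exp1rz mul1r.
Qed.

(** The form a^2 + b^2 - y a b is invariant under the step (a, b) -> (b, y b - a) of the
    recurrence. *)
Lemma fval_quad k y : F (k - 1) y ^+ 2 + F k y ^+ 2 - y * F (k - 1) y * F k y = 1.
Proof.
apply: (@int_ind2 (fun k => F (k - 1) y ^+ 2 + F k y ^+ 2 - y * F (k - 1) y * F k y = 1))
  => [||{}k _ <-|{}k <- _].
- by rewrite sub0r fvalN1 fval0; ring.
- by rewrite subrr fval0 fval1; ring.
- by rewrite addrK fval_succ; ring.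
- by have := fval_succ (k - 1) y; rewrite subrK => ->; ring.
Qed.

Lemma fpow k s : s != 0 -> s ^ k = F k (s + s^-1) * s - F (k - 1) (s + s^-1).
Proof.
move=> s0; rewrite (@rec_solution1 (s + s^-1) (fun k => s ^ k)).
  by rewrite expr1z expr0z mulr1.
by move=> {}k; rewrite !expfzDr // expr1z exprN1; ring.
Qed.

(** The Binet formula f_k = (s^k - s^-k) / (s - s^-1), multiplied out so that s = 1 and s = -1 are
    allowed. *)
Lemma fpow_sub k s : s != 0 -> F k (s + s^-1) * (s - s^-1) = s ^ k - s ^ (- k).
Proof.
move=> s0; rewrite -exprz_inv fpow // fpow ?invr_eq0 // invrK [s^-1 + s]addrC; ring.
Qed.

Lemma trace_root y : exists2 s : C, s != 0 & y = s + s^-1.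
Proof.
pose s := (y + sqrtC (y ^+ 2 - 4)) / 2.
have e : s * (y - s) = 1.
  have -> : s * (y - s) = (y ^+ 2 - sqrtC (y ^+ 2 - 4) ^+ 2) / 4 by rewrite /s; field.
  by rewrite sqrtCK; field.
have s0 : s != 0 by apply: contra_eq_neq e => ->; rewrite mul0r eq_sym oner_eq0.
by exists s => //; apply: (mulfI s0); rewrite mulrDr divff // -e; ring.
Qed.

Lemma trace_inj s t : s != 0 -> t != 0 -> s + s^-1 = t + t^-1 -> t = s \/ t = s^-1.
Proof.
move=> s0 t0 e; have : (t - s) * (t - s^-1) = 0.
  rewrite mulrBl !mulrBr divff //; have -> : s * t = t * t + 1 - t * s^-1.
    have -> : t * t + 1 = t * (t + t^-1) by rewrite mulrDr divff.
    by rewrite -e; ring.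
  by ring.
by move/eqP; rewrite mulf_eq0 !subr_eq0 => /orP [] /eqP; [left|right].
Qed.

(* d/dy (s^k + s^-k) = k (s^k - s^-k) / (s - s^-1) for y = s + s^-1. *)
Lemma deriv_fdiff k y :
  (fpoly C (k + 1) - fpoly C (k - 1))^`().[y] = k%:~R * F k y.
Proof.
pose D k := (fpoly C k)^`().[y].
have recD j : D (j + 1) = F j y + y * D j - D (j - 1).
  have /(congr1 (fun p => p^`().[y])) := fpoly_rec C j.
  rewrite !derivE !hornerE /= -/(D _) -/(D _) => <-.
  by rewrite addrAC subrr add0r.
apply/eqP; rewrite -subr_eq0 derivB hornerD hornerN -/(D _) -/(D _); apply/eqP.
apply: (@rec_eq0 C^o y (fun k => D (k + 1) - D (k - 1) - k%:~R * F k y)).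
- move=> {}k; rewrite subrK addrK !recD !addrK !rmorphD rmorphN /= fval_succ.
  have := recD (k - 1); rewrite subrK => ->.
  have := fval_succ (k - 1) y; rewrite subrK => ->.
  rewrite /GRing.scale /=; ring.
- by rewrite /D fval0 add0r sub0r /= derivN -polyC1 derivC oppr0 horner0; ring.
- have -> : D (1 + 1) = F 1 y + y * D 1 - D (1 - 1) by apply: recD.
  by rewrite fval1 subrr /D /= -polyC1 derivC deriv0 horner0; ring.
Qed.

End FPolynomials.

(** * Pairs of matrices in SL_2 and the relation of Gamma_n *)

Section Mx2.
Variable C : numClosedFieldType.
Implicit Types (A B : 'M[C]_2) (k n : int).

Local Notation F k y := (fpoly C k).[y].

Lemma ord2P (k : 'I_2) : k = 0 \/ k = 1.
Proof. by case: k => [[|[|//]] ?]; [left|right]; apply/val_inj. Qed.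

Lemma mx2P A B : A 0 0 = B 0 0 -> A 0 1 = B 0 1 -> A 1 0 = B 1 0 -> A 1 1 = B 1 1 ->
  A = B.
Proof.
move=> h00 h01 h10 h11; apply/matrixP => i j.
by case: (ord2P i) => ->; case: (ord2P j) => ->.
Qed.

Lemma mxtrace2E A : \tr A = A 0 0 + A 1 1.
Proof.
rewrite /mxtrace !big_ord_recl big_ord0 addr0.
by congr (_ + A _ _); apply/val_inj.
Qed.

Lemma mulmx2E A B i j : (A * B) i j = A i 0 * B 0 j + A i 1 * B 1 j.
Proof.
rewrite mxE !big_ord_recl big_ord0 addr0.
by congr (_ + A _ _ * B _ _); apply/val_inj.
Qed.

Lemma det2E A : \det A = A 0 0 * A 1 1 - A 0 1 * A 1 0.
Proof.
rewrite (expand_det_row _ 0) !big_ord_recl big_ord0 /cofactor !det_mx11 !mxE /=.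
have l1 : lift ord0 ord0 = 1 :> 'I_2 by apply/val_inj.
have l2 : lift 1 0 = 0 :> 'I_2 by apply/val_inj.
by rewrite /bump /= !l1 !l2 expr0 expr1; ring.
Qed.

(** For invertible B this is Cayley-Hamilton for A B, multiplied on the right by the inverse of B;
    tr B - B is the adjugate of B. *)
Lemma mul_sandwich A B :
  A * B * A = \tr (A * B) *: A - \det A *: (\tr B *: 1 - B).
Proof.
by apply: mx2P; rewrite det2E !mxtrace2E !(mulmx2E, mxE) /=; ring.
Qed.

Lemma cayley_hamilton2 A : A ^+ 2 = \tr A *: A - \det A *: 1.
Proof.
by apply: mx2P; rewrite det2E !mxtrace2E expr2 !(mulmx2E, mxE) /=; ring.
Qed.

Lemma det1_unit A : \det A = 1 -> A \is a GRing.unit.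
Proof. by move=> dA; rewrite -[_ \is a _]/(A \in unitmx) unitmxE dA unitr1. Qed.

Lemma det1_inv A : \det A = 1 -> A^-1 = \tr A *: 1 - A.
Proof.
move=> dA; apply: (mulrI (det1_unit dA)); rewrite divrr ?det1_unit //.
rewrite mulrBr -scalerAr mulr1 -expr2 cayley_hamilton2 dA scale1r.
by rewrite opprB addrCA subrr addr0.
Qed.

Lemma mxpow B k : \det B = 1 -> B ^ k = F k (\tr B) *: B - F (k - 1) (\tr B) *: 1.
Proof.
move=> dB; have uB := det1_unit dB.
rewrite (@rec_solution C _ (\tr B) (fun k => B ^ k)) ?expr1z ?expr0z // => {}k.
by rewrite !exprzDr // exprN1 expr1z -mulrDr det1_inv // subrK -scalerAr mulr1.
Qed.

Lemma fvalN k (y : C) : F (- k) y = - F k y.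
Proof.
rewrite (@rec_solution1 C y (fun k => F (- k) y)) => [|{}k].
  by rewrite oppr0 fval0 fvalN1; ring.
by rewrite addrC !opprD opprK fval_rec.
Qed.

(** Multiplying by A on both sides clears the inverses in [rel_word], leaving B A^2 B. Then B^-n and
    A^2 are linear in B and A, and the products A B A and B A B reduce by [mul_sandwich]. *)
Lemma relation_linear n (e : C) A B : \det A = 1 -> \det B = 1 ->
  let: (x, y, z) := (\tr A, \tr B, \tr (A * B)) in
  A * (B ^ (- n) - e *: rel_word A B) * A =
  (x * F (n + 1) y - z * F n y - e * x) *: A + (e * (y - x * z) - F n y) *: B
   + (F (n - 1) y - e * (1 - x ^+ 2)) *: 1.
Proof.
move=> dA dB; set x := \tr A; set y := \tr B; set z := \tr (A * B).
have uA := det1_unit dA.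
have AWA : A * rel_word A B * A = B * A ^+ 2 * B.
  by rewrite /rel_word !mulrA divrr // mul1r mulrVK.
have ABA : A * B * A = z *: A - y *: 1 + B.
  by rewrite mul_sandwich dA scale1r opprB addrCA addrC.
have BAB : B * A * B = z *: B - x *: 1 + A.
  rewrite mul_sandwich dB scale1r opprB addrCA addrC.
  by rewrite -[\tr (B * A)]/(\tr (B *m A)) mxtrace_mulC.
have A2 : A ^+ 2 = x *: A - 1 by rewrite cayley_hamilton2 dA scale1r.
have B2 : B ^+ 2 = y *: B - 1 by rewrite cayley_hamilton2 dB scale1r.
rewrite mulrBr mulrBl -scalerAr -scalerAl AWA mxpow // -/y.
rewrite mulrBr mulrBl -!scalerAr -!scalerAl mulr1 ABA -expr2 A2.
rewrite mulrBr mulrBl -scalerAr -scalerAl mulr1 BAB -expr2 B2.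
rewrite -opprD !fvalN.
have -> : F (n + 1) y = y * F n y - F (n - 1) y by apply: fval_succ.
(* Generalising the identity matrix keeps its entries as atoms for [ring]. *)
apply/matrixP => i j; move: (1 : 'M[C]_2) => I; rewrite !mxE; ring.
Qed.

Definition char_eqs n (e x y z : C) : Prop :=
  [/\ x * F (n + 1) y - z * F n y = e * x, x * z = y - e * F n y
    & x ^+ 2 = 1 - e * F (n - 1) y].

Lemma relation_of_char_eqs n (e : C) A B : \det A = 1 -> \det B = 1 -> e ^+ 2 = 1 ->
  char_eqs n e (\tr A) (\tr B) (\tr (A * B)) -> B ^ (- n) = e *: rel_word A B.
Proof.
move=> dA dB e2 [h1 h2 h3]; have uA := det1_unit dA.
have := relation_linear n e dA dB; rewrite h1 h2 h3 subrr.
have -> : e * (\tr B - (\tr B - e * F n (\tr B))) - F n (\tr B) = 0.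
  by transitivity ((e ^+ 2 - 1) * F n (\tr B)); [ring|rewrite e2 subrr mul0r].
have -> : F (n - 1) (\tr B) - e * (1 - (1 - e * F (n - 1) (\tr B))) = 0.
  by transitivity ((1 - e ^+ 2) * F (n - 1) (\tr B)); [ring|rewrite e2 subrr mul0r].
rewrite !scale0r !addr0 => h; apply/subr0_eq.
by apply: (mulrI uA); apply: (mulIr uA); rewrite h mulr0 mul0r.
Qed.

Lemma one_mulmx2 (v : 'cV[C]_2) : (1 : 'M[C]_2) *m v = v.
Proof. exact: mul1mx. Qed.

Lemma eigenvector_exists A : exists v : 'cV[C]_2, v != 0 /\ exists a : C, A *m v = a *: v.
Proof.
pose D := sqrtC ((A 0 0 - A 1 1) ^+ 2 + 4 * A 0 1 * A 1 0).
pose a := (A 0 0 + A 1 1 + D) / 2.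
(* The transpose appears because [det0P] produces a row vector in the left kernel. *)
have : \det (A - a *: 1)^T == 0.
  rewrite det_tr det2E !mxE /= mulr1n mulr0n.
  have -> : (A 0 0 - a * 1) * (A 1 1 - a * 1) - (A 0 1 - a * 0) * (A 1 0 - a * 0) =
    (D ^+ 2 - ((A 0 0 - A 1 1) ^+ 2 + 4 * A 0 1 * A 1 0)) / 4 by rewrite /a; field.
  by rewrite sqrtCK subrr mul0r.
case/det0P => w w0 /(congr1 trmx); rewrite trmx_mul trmxK trmx0 => e.
exists w^T; split; first by apply: contra_neq w0 => /(congr1 trmx); rewrite trmxK trmx0.
exists a; apply/eqP; rewrite -subr_eq0 -e mulmxBl -scalemxAl; apply/eqP.
by congr (_ - _ *: _); rewrite one_mulmx2.
Qed.

(** If A is a combination of B and 1, every eigenvector of B is one of A; if B is a multiple of 1,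
    every eigenvector of A is one of B. *)
Lemma irreducible_free A B (c1 c2 c3 : C) : irreducible_rep A B ->
  c1 *: A + c2 *: B + c3 *: 1 = 0 -> [/\ c1 = 0, c2 = 0 & c3 = 0].
Proof.
move=> irr h.
have act (v : 'cV[C]_2) : c1 *: (A *m v) + c2 *: (B *m v) + c3 *: v = 0.
  have := congr1 (fun M => M *m v) h; rewrite mul0mx !mulmxDl -!scalemxAl.
  by rewrite one_mulmx2.
have [c10|c10] := eqVneq c1 0; last first.
  case: irr; have [v [v0 [b hb]]] := eigenvector_exists B.
  exists v; split=> //; last by exists b.
  exists (- (c2 * b + c3) / c1); apply: (scalerI c10).
  move: (act v); rewrite hb !scalerA [c1 * _]mulrC mulfVK // -addrA -scalerDl.
  by move/eqP; rewrite addr_eq0 scaleNr => /eqP.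
have [c20|c20] := eqVneq c2 0; last first.
  case: irr; have [v [v0 [a ha]]] := eigenvector_exists A.
  exists v; split=> //; first by exists a.
  exists (- c3 / c2); apply: (scalerI c20).
  move: (act v); rewrite c10 scale0r add0r !scalerA [c2 * _]mulrC mulfVK //.
  by move/eqP; rewrite addr_eq0 scaleNr => /eqP.
split=> //; have [v [v0 _]] := eigenvector_exists A.
move: (act v); rewrite c10 c20 !scale0r !add0r => /eqP.
by rewrite scaler_eq0 (negbTE v0) orbF => /eqP.
Qed.

Lemma char_eqs_irreducible n (e : C) A B : \det A = 1 -> \det B = 1 -> e ^+ 2 = 1 ->
  irreducible_rep A B -> B ^ (- n) = e *: rel_word A B ->
  char_eqs n e (\tr A) (\tr B) (\tr (A * B)).
Proof.
move=> dA dB e2 irr h; have := relation_linear n e dA dB.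
rewrite h subrr mulr0 mul0r => /esym /(irreducible_free irr) [h1 h2 h3].
set x := \tr A in h1 h2 h3 *; set y := \tr B in h1 h2 h3 *; set z := \tr _ in h1 h2 h3 *.
have e0 : e * e = 1 by rewrite -expr2.
split; first exact: subr0_eq.
- apply/esym/eqP; rewrite -subr_eq0; apply/eqP.
  transitivity (e * (e * (y - x * z) - F n y) + (1 - e * e) * (y - x * z)); first by ring.
  by rewrite h2 e0 subrr mul0r mulr0 addr0.
- apply/esym/eqP; rewrite -subr_eq0; apply/eqP.
  transitivity ((1 - e * e) * (1 - x ^+ 2) - e * (F (n - 1) y - e * (1 - x ^+ 2))).
    by ring.
  by rewrite h3 e0 subrr mul0r mulr0 subr0.
Qed.

Lemma eigenvalue_trace A (v : 'cV[C]_2) (a : C) : \det A = 1 -> v != 0 ->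
  A *m v = a *: v -> a != 0 /\ \tr A = a + a^-1.
Proof.
move=> dA v0 h; have : A *m (A *m v) = (\tr A * a - 1) *: v.
  rewrite mulmxA -[A *m A]/(A ^+ 2) cayley_hamilton2 dA scale1r mulmxBl -scalemxAl h.
  by rewrite scalerBl scale1r scalerA one_mulmx2.
rewrite h -scalemxAr h scalerA => /eqP; rewrite -subr_eq0 -scalerBl scaler_eq0.
rewrite (negbTE v0) orbF => /eqP e.
have a0 : a != 0.
  apply: contra_eq_neq e => ->; rewrite !mulr0 sub0r sub0r opprK; exact: oner_neq0.
split=> //; apply: (mulIf a0); rewrite mulrDl mulVf // ; apply/eqP.
by rewrite -subr_eq0 -oppr_eq0 -e; apply/eqP; ring.
Qed.

Lemma eigenvalue_pow A (v : 'cV[C]_2) (a : C) k : \det A = 1 -> v != 0 ->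
  A *m v = a *: v -> A ^ k *m v = a ^ k *: v.
Proof.
move=> dA v0 h; have [a0 tA] := eigenvalue_trace dA v0 h.
rewrite mxpow // fpow // -tA mulmxBl -!scalemxAl h scalerBl scalerA.
by rewrite one_mulmx2.
Qed.

Definition eigen_pair A B (a b : C) : Prop :=
  [/\ a != 0, b != 0 & [/\ \tr A = a + a^-1, \tr B = b + b^-1
    & \tr (A * B) = a * b + (a * b)^-1]].

(** On a common eigenline the relation becomes scalar and the powers of a cancel: a^-1 b a^2 b a^-1
    = b^2. *)
Lemma reducible_eigen_pair n A B : \det A = 1 -> \det B = 1 -> ~ irreducible_rep A B ->
  exists a b, eigen_pair A B a b /\
    forall e : C, B ^ (- n) = e *: rel_word A B -> b ^ (- n) = e * b ^+ 2.
Proof.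
move=> dA dB /contrapT [v [v0 [a ha] [b hb]]].
have [a0 tA] := eigenvalue_trace dA v0 ha; have [b0 tB] := eigenvalue_trace dB v0 hb.
have dAB : \det (A * B) = 1 by rewrite det_mulmx dA dB mul1r.
have hab : (A * B) *m v = (a * b) *: v.
  by rewrite -mulmxA hb -scalemxAr ha scalerA mulrC.
have [_ tAB] := eigenvalue_trace dAB v0 hab.
exists a, b; split; first by split.
move=> e /(congr1 (fun M => M *m v)).
rewrite (eigenvalue_pow _ dB v0 hb) -scalemxAl /rel_word -!mulmxA.
have hA' : A^-1 *m v = a^-1 *: v.
  by have := eigenvalue_pow (-1) dA v0 ha; rewrite !exprN1.
do 6 rewrite ?hA' ?hb ?ha -?scalemxAr.
rewrite !scalerA => /eqP; rewrite -subr_eq0 -scalerBl scaler_eq0 (negbTE v0) orbF subr_eq0.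
by move/eqP => ->; field.
Qed.

(** By Fricke's identity this is the trace of the commutator of A and B, minus 2. *)
Definition kappa (x y z : C) : C := x ^+ 2 + y ^+ 2 + z ^+ 2 - x * y * z - 4.

Lemma eigen_pair_kappa A B a b : eigen_pair A B a b ->
  kappa (\tr A) (\tr B) (\tr (A * B)) = 0.
Proof. by move=> [a0 b0 [-> -> ->]]; rewrite /kappa; field; rewrite a0 b0. Qed.

Lemma kappa_irreducible A B : \det A = 1 -> \det B = 1 ->
  kappa (\tr A) (\tr B) (\tr (A * B)) != 0 -> irreducible_rep A B.
Proof.
move=> dA dB /eqP k0; apply: contrapT => /(reducible_eigen_pair 0 dA dB) [a [b [h _]]].
exact: k0 (eigen_pair_kappa h).
Qed.

Lemma traces_exist (x y z : C) : exists A B,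
  [/\ \det A = 1, \det B = 1, \tr A = x, \tr B = y & \tr (A * B) = z].
Proof.
have [t t0 tz] := trace_root z.
pose mx2 (p q r s : C) : 'M[C]_2 :=
  \matrix_(i, j) if i == 0 then if j == 0 then p else q else if j == 0 then r else s.
(* The diagonal entries of the product are t^-1 and t, whose sum is z. *)
exists (mx2 x (-1) 1 0), (mx2 0 t (- t^-1) y).
by rewrite !det2E !mxtrace2E !mulmx2E !mxE /= tz; split; field.
Qed.

(** The relation holds at every solution, reducible or not; this is how reducible characters on the
    non-lifting curve are realised. *)
Lemma char_point n (e x y z : C) : e ^+ 2 = 1 -> char_eqs n e x y z ->
  exists A B, [/\ \det A = 1, \det B = 1, B ^ (- n) = e *: rel_word A B,
    kappa x y z != 0 -> irreducible_rep A B
    & [/\ \tr A = x, \tr B = y & \tr (A * B) = z]].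
Proof.
move=> e2 h; have [A [B [dA dB tA tB tAB]]] := traces_exist x y z.
exists A, B; split=> //; first by apply: relation_of_char_eqs => //; rewrite tA tB tAB.
by move=> k0; apply: kappa_irreducible => //; rewrite tA tB tAB.
Qed.

Lemma rel_word_signs A B A' B' : A' = A \/ A' = - A -> B' = B \/ B' = - B ->
  rel_word A' B' = rel_word A B.
Proof.
by move=> [->|->] [->|->]; rewrite /rel_word ?invrN ?sqrrN ?(mulrN, mulNr) ?opprK.
Qed.

Lemma expz_even_signs n B B' : (2 %| n)%Z -> B' = B \/ B' = - B -> B' ^ n = B ^ n.
Proof.
case/dvdzP => m ->; rewrite mulrC -!exprz_exp -!exprnP.
by case=> ->; rewrite ?sqrrN.
Qed.

(** For n even both sides of the relation are insensitive to the signs of A and B, so if some choice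
    of lifts satisfies it, every choice does. *)
Lemma liftableE n A B : (2 %| n)%Z -> liftable n A B -> sl_rep n A B.
Proof.
move=> n2 [A' [B' [hA hB [dA dB rel]]]].
have det_sign (M M' : 'M[C]_2) : M' = M \/ M' = - M -> \det M' = 1 -> \det M = 1.
  by case=> -> //; have -> : \det (- M) = \det M by rewrite !det2E !mxE; ring.
split; [exact: det_sign hA dA|exact: det_sign hB dB|].
by rewrite -(rel_word_signs hA hB) -rel (expz_even_signs _ hB) // rpredN.
Qed.

Lemma rel_word_unit A B : \det A = 1 -> \det B = 1 -> rel_word A B != 0.
Proof.
move=> dA dB; have : rel_word A B \is a GRing.unit.
  have [uA uB] := (det1_unit dA, det1_unit dB).
  by rewrite /rel_word !unitrMl ?unitrX ?unitrV.
by apply: contraTneq => ->; rewrite unitr0.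
Qed.

Lemma nonliftableE n A B : (2 %| n)%Z ->
  (psl_rep n A B /\ ~ liftable n A B) <->
  [/\ \det A = 1, \det B = 1 & B ^ (- n) = -1 *: rel_word A B].
Proof.
move=> n2; rewrite scaleN1r; split=> [[[dA dB [h|h]]] nl|[dA dB h]] //.
  by case: nl; exists A, B; split; [left|left|split].
split; first by split=> //; right.
move=> /(liftableE n2) [_ _]; rewrite h => /eqP.
rewrite eq_sym -subr_eq0 opprK -mulr2n -scaler_nat scaler_eq0 pnatr_eq0 /=.
by rewrite (negbTE (rel_word_unit dA dB)).
Qed.

End Mx2.

(** * Roots of unity, and the order of alpha *)

Section RootsOfUnity.
Variable C : numClosedFieldType.
Implicit Types (N : int) (s yb : C).

Lemma expz_abs_eq1 N s : (s ^+ `|N|%N = 1) <-> (s ^ N = 1).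
Proof.
case: N => k; first by rewrite -exprnP.
by rewrite NegzE abszN absz_nat -exprnN; split => [->|/eqP]; [rewrite invr1|rewrite invr_eq1 => /eqP].
Qed.

Lemma expz_eq1_neq0 N s : N != 0 -> s ^ N = 1 -> s != 0.
Proof.
by move=> N0; apply: contra_eq_neq => ->; rewrite exp0rz (negbTE N0) eq_sym oner_eq0.
Qed.

(** A root of unity has modulus 1, so its inverse is its conjugate. *)
Lemma RsetP N s : N != 0 -> Rset N s <-> exists2 z : C, z ^ N = 1 & s = z + z^-1.
Proof.
move=> N0; have N0' : (0 < `|N|)%N by rewrite absz_gt0.
have key (z : C) : z ^ N = 1 -> 2 * 'Re z = z + z^-1.
  move=> zN; have /eqP : `|z| ^+ `|N|%N = 1 by rewrite -normrX (proj2 (expz_abs_eq1 N z) zN) normr1.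
  rewrite pexpr_eq1 // => /eqP nz.
  by rewrite invC_norm nz expr1n invr1 mul1r ReE; field.
split=> -[z hz ->]; exists z.
- exact/expz_abs_eq1.
- exact/key/expz_abs_eq1.
- exact/expz_abs_eq1.
- exact/esym/key.
Qed.

(** A root of unity z of order dividing 2N has z^N = 1 or z^N = -1, and the difference selects the
    second. The square of the trace identifies z with its inverse and with - z, neither of which
    affects this condition for N even. *)
Lemma sqset_Rfib_diff N yb : N != 0 -> (2 %| N)%Z ->
  (sqset (Rfib (2 * N)) `\` sqset (Rfib N)) yb <->
  exists2 s, s ^ N = -1 & yb = (s + s^-1) ^+ 2.
Proof.
move=> N0 N2; have N20 : 2 * N != 0 by rewrite mulf_neq0.
have even_sign s t : t = s \/ t = - s -> t ^ N = s ^ N.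
  case/dvdzP: N2 => m ->; rewrite mulrC -!exprz_exp -!exprnP.
  by case=> ->; rewrite ?sqrrN.
split.
  move=> [[y [/(RsetP _ N20) [z zN yE] yfib] <-] hN].
  exists z; last by rewrite yE.
  have /eqP : (z ^ N) ^+ 2 = 1 by rewrite exprnP exprz_exp mulrC.
  rewrite sqrf_eq1 => /orP [/eqP zN1|/eqP //].
  by case: hN; exists y => //; split=> //; apply/RsetP => //; exists z.
move=> [s sN ->].
have s1 : s ^ N != 1.
  by rewrite sN -subr_eq0 -opprD oppr_eq0 -mulr2n pnatr_eq0.
have s0 : s != 0.
  by apply: (@expz_eq1_neq0 (2 * N)) => //; rewrite mulrC -exprz_exp sN -exprnP sqrrN expr1n.
(* A trace of 2 or -2, excluded from [Rfib], would force s = 1 or s = -1, hence s^N = 1. *)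
have sgn1 (e : C) : e = 1 \/ e = -1 -> s + s^-1 = e + e -> False.
  move=> he; have e1 : e^-1 = e by case: he => ->; rewrite ?invr1 ?invrN1.
  have e0 : e != 0 by case: he => ->; rewrite ?oppr_eq0 oner_eq0.
  rewrite -{2}e1 => /esym/trace_inj -/(_ e0 s0) h.
  have {h} : s = e by case: h => //; rewrite e1.
  move=> se; case/eqP: s1; rewrite se.
  have -> : e ^ N = 1 ^ N by apply: even_sign.
  by rewrite exp1rz.
split.
  exists (s + s^-1) => //; split.
    apply/RsetP => //; exists s => //.
    by rewrite mulrC -exprz_exp sN -exprnP sqrrN expr1n.
  by case=> h; [apply: (sgn1 1)|apply: (sgn1 (-1))]; rewrite ?h; auto; ring.
move=> [y [/(RsetP _ N0) [t tN yE] _]] /eqP; rewrite yE eqf_sqr.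
have t0 : t != 0 by apply: expz_eq1_neq0 tN.
have inv_pow (u : C) : u ^ N = 1 -> u^-1 ^ N = 1 by rewrite exprz_inv -invr_expz => ->; rewrite invr1.
case/orP => /eqP e; case/eqP: s1.
  by case: (trace_inj t0 s0 e) => ->; auto.
have e' : - t + (- t)^-1 = s + s^-1 by rewrite invrN -opprD e opprK.
have tN' : (- t) ^ N = 1 by rewrite (even_sign t) //; right.
have t0' : - t != 0 by rewrite oppr_eq0.
by case: (trace_inj t0' s0 e') => ->; auto.
Qed.

End RootsOfUnity.

Section AlphaOrder.

Definition alpha_exp (w : word) : int :=
  \sum_(s <- w) match s with Alpha => 1 | AlphaInv => -1 | _ => 0 end.

(** The relation has exponent sum -1 + 2 - 1 = 0 in alpha, so counting alpha is a homomorphism from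
    the group onto the integers. *)
Lemma alpha_exp_gamma n u v : gamma_eq n u v -> alpha_exp u = alpha_exp v.
Proof.
elim=> {u v} [|u v _ ->|u v w _ -> _ ->|u u' v v' _ e1 _ e2|s|] //.
- by move: e1 e2; rewrite /alpha_exp !big_cat /= => -> ->.
- by case: s; rewrite /alpha_exp !big_cons big_nil.
- suff -> : forall k, alpha_exp (beta_pow k) = 0 by rewrite /alpha_exp !big_cons big_nil.
  have nseq0 s j : alpha_exp (nseq j s) = (match s with Alpha => 1 | AlphaInv => -1 | _ => 0 end) *+ j.
    by rewrite /alpha_exp big_nseq iter_addr addr0.
  by case=> k; rewrite nseq0 mul0rn.
Qed.

Lemma alpha_infinite_order n k : gamma_eq n (nseq k Alpha) [::] -> k = 0%N.
Proof.
move/alpha_exp_gamma; rewrite /alpha_exp big_nseq iter_addr addr0 big_nil.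
by move/eqP; rewrite mulrn_eq0 => /orP [/eqP|].
Qed.

Variable C : numClosedFieldType.
Implicit Types A B : 'M[C]_2.

Lemma word_val_alpha A B k : word_val A B (nseq k Alpha) = A ^+ k.
Proof. by rewrite /word_val big_nseq iter_mulr mulr1. Qed.

(** Trace 0 gives A^2 = -1 by Cayley-Hamilton, so A would have order dividing 4. *)
Lemma sl_faithful_trace n A B : \det A = 1 -> sl_discrete_faithful n A B -> \tr A != 0.
Proof.
move=> dA [h _]; apply/eqP => t0; suff /h /alpha_infinite_order : word_val A B (nseq 4 Alpha) = 1 by [].
have A2 : A ^+ 2 = -1 by rewrite cayley_hamilton2 dA t0 scale0r sub0r scale1r.
by rewrite word_val_alpha (exprM A 2 2) A2 sqrrN expr1n.
Qed.

Lemma psl_faithful_trace n A B : \det A = 1 -> psl_discrete_faithful n A B ->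
  (\tr A) ^+ 2 != 0 /\ (\tr A) ^+ 2 != 1.
Proof.
move=> dA [h _]; split; apply/eqP.
  move/eqP; rewrite expf_eq0 /= => /eqP t0.
  suff /h /alpha_infinite_order : word_val A B (nseq 2 Alpha) = 1 \/
    word_val A B (nseq 2 Alpha) = -1 by [].
  by right; rewrite word_val_alpha cayley_hamilton2 dA t0 scale0r sub0r scale1r.
move=> t2; suff /h /alpha_infinite_order : word_val A B (nseq 3 Alpha) = 1 \/
    word_val A B (nseq 3 Alpha) = -1 by [].
have -> : word_val A B (nseq 3 Alpha) = - \tr A *: 1.
  rewrite word_val_alpha exprS cayley_hamilton2 dA scale1r mulrBr mulr1 -scalerAr -expr2.
  rewrite cayley_hamilton2 dA scale1r scalerBr scalerA -expr2 t2 scale1r.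
  by rewrite addrAC subrr add0r scaleNr.
by move/eqP: t2; rewrite sqrf_eq1 => /orP [] /eqP ->; [right|left];
  rewrite ?scaleN1r ?opprK ?scale1r.
Qed.

End AlphaOrder.

(** * Rational maps and sign changes *)

Section EvenPolynomials.
Variable C : numClosedFieldType.

Lemma even_poly_sqr (p : {poly C}) : (forall y, p.[- y] = p.[y]) ->
  exists q : {poly C}, forall y, q.[y ^+ 2] = p.[y].
Proof.
move=> h; exists (even_poly p) => y.
have E z : p.[z] = (even_poly p).[z ^+ 2] + (odd_poly p).[z ^+ 2] * z.
  by rewrite -{1}(poly_even_odd p) hornerD hornerM !horner_comp hornerXn hornerX.
have := h y; rewrite !E sqrrN mulrN => /addrI /eqP.
rewrite -subr_eq0 -opprD oppr_eq0 -mulr2n mulrn_eq0 /= => /eqP ->.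
by rewrite addr0.
Qed.

Lemma horner1 (y : C) : (1 : {poly C}).[y] = 1.
Proof. by rewrite -polyC1 hornerC. Qed.

End EvenPolynomials.

Section RationalMaps.
Variable C : numClosedFieldType.

Lemma ratmap1 k (a d : pt C k -> C) : polyfun a -> polyfun d ->
  exists phi : ratmap C k 1, (forall p, peval (rden phi) p = d p) /\
    (forall p, reval phi p = [tuple a p / d p]).
Proof.
move=> [A hA] [D hD]; exists (RatMap [tuple A] D); split=> p //.
by apply/val_inj; rewrite /= hA hD.
Qed.

Lemma ratmap2 k (a b d : pt C k -> C) : polyfun a -> polyfun b -> polyfun d ->
  exists phi : ratmap C k 2, (forall p, peval (rden phi) p = d p) /\
    (forall p, reval phi p = [tuple a p / d p; b p / d p]).
Proof.
move=> [A hA] [B hB] [D hD]; exists (RatMap [tuple A; B] D); split=> p //.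
by apply/val_inj; rewrite /= hA hB hD.
Qed.

Lemma ratmap3 k (a b c d : pt C k -> C) :
  polyfun a -> polyfun b -> polyfun c -> polyfun d ->
  exists phi : ratmap C k 3, (forall p, peval (rden phi) p = d p) /\
    (forall p, reval phi p = [tuple a p / d p; b p / d p; c p / d p]).
Proof.
move=> [A hA] [B hB] [E hE] [D hD]; exists (RatMap [tuple A; B; E] D); split=> p //.
by apply/val_inj; rewrite /= hA hB hE hD.
Qed.

(** A single point p where both maps can be composed settles all nonemptiness conditions;
    [reval phi p] serves for the opposite composite. *)
Lemma birational_mapI k l (phi : ratmap C k l) (psi : ratmap C l k)
    (V : set (pt C k)) (W : set (pt C l)) : is_variety V -> is_variety W ->
  (forall p, rdom phi V p -> W (reval phi p)) ->
  (forall q, rdom psi W q -> V (reval psi q)) ->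
  (forall p, rdom phi V p -> rdom psi W (reval phi p) -> reval psi (reval phi p) = p) ->
  (forall q, rdom psi W q -> rdom phi V (reval psi q) -> reval phi (reval psi q) = q) ->
  (exists2 p, rdom phi V p & rdom psi W (reval phi p)) ->
  birational_map phi V W.
Proof.
move=> vV vW hphi hpsi hK hK' [p hp hq]; split=> //; first by split=> //; exists p.
exists psi; split.
- by split=> //; exists (reval phi p).
- by split=> //; exists p.
- by split=> //; exists (reval phi p); rewrite ?hK.
Qed.

Lemma affine_line_variety : is_variety (@affine_line C).
Proof.
split; first exact: zclosedT.
have -> : @affine_line C = [set p | exists2 y, (1 : {poly C}).[y] != 0 & p = [tuple y]].
  apply/seteqP; split => // p _; exists p`_0; first by rewrite horner1 oner_neq0.
  by apply/val_inj; case: p => -[|x []].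
apply: line_image_irreducible; first exact: oner_neq0.
by case=> // _; exists 0%N, 'X => y _; rewrite expr0 mulr1 hornerX.
Qed.

Lemma birational_graph (V : set (pt C 3)) (d a c : {poly C}) : is_variety V -> d != 0 ->
  (forall y, d.[y] != 0 -> V [tuple a.[y]; y; c.[y] / d.[y]]) ->
  (forall p, V p -> d.[p`_1] != 0 -> p = [tuple a.[p`_1]; p`_1; c.[p`_1] / d.[p`_1]]) ->
  birational V (@affine_line C).
Proof.
move=> vV d0 hV hE.
have [phi [phid phiE]] := ratmap1 (@polyfun_coord C 3 1) (polyfun_cst 3 1).
have pc := @polyfun_coord C 1 0; have ph q := polyfun_horner q pc.
(* The inverse y -> (a, y, c / d), its first two coordinates multiplied by d to share the
   denominator. *)
have [psi [psid psiE]] := ratmap3 (polyfunM (ph a) (ph d)) (polyfunM pc (ph d)) (ph c) (ph d).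
have psi' (q : pt C 1) : d.[q`_0] != 0 -> reval psi q = [tuple a.[q`_0]; q`_0; c.[q`_0] / d.[q`_0]].
  by move=> dq; rewrite psiE !mulfK.
exists phi; apply: (@birational_mapI _ _ phi psi) => //; first exact: affine_line_variety.
- by move=> q [_]; rewrite psid => dq; rewrite psi' //; apply: hV.
- move=> p [Vp _]; rewrite phiE divr1 => -[_]; rewrite psid => dp.
  by rewrite psi' //= -hE.
- move=> q [_]; rewrite psid => dq _; rewrite phiE psi' //= divr1.
  by apply/val_inj; case: q {dq} => -[|x []].
- have [y dy] := nonroot_exists d0.
  exists [tuple a.[y]; y; c.[y] / d.[y]].
    by split; [apply: hV|rewrite phid oner_neq0].
  by split=> //; rewrite psid phiE /= divr1.
Qed.

Lemma F_identifiedP (p q : pt C 2) : F_identified p q <->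
  exists b c : C, [/\ b ^+ 2 = 1, c ^+ 2 = 1 & q = [tuple b * p`_0; c * p`_1]].
Proof.
split.
  elim=> {p q} [p|p|p|p q _ [b [c [b2 c2 ->]]]|p q r _ [b [c [b2 c2 ->]]] _ [b' [c' [b2' c2' ->]]]].
  - by exists 1, (-1); rewrite sqrrN expr1n mul1r mulN1r.
  - by exists (-1), 1; rewrite sqrrN expr1n mul1r mulN1r.
  - by exists 1, 1; rewrite expr1n !mul1r -pt2E.
  - by exists b, c; split; rewrite //= !mulrA -!expr2 b2 c2 !mul1r -pt2E.
  - by exists (b' * b), (c' * c); rewrite !exprMn b2 b2' c2 c2' mulr1 !mulrA.
move=> [b [c [/eqP b2 /eqP c2 ->]]].
move: b2 c2; rewrite !sqrf_eq1 => /orP [] /eqP -> /orP [] /eqP ->; rewrite ?mul1r ?mulN1r.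
- by rewrite -pt2E; apply: F_id_refl.
- exact: F_id_hyp.
- exact: F_id_neg.
- exact: F_id_trans (F_id_hyp p) (F_id_neg _).
Qed.

Lemma sqr_eq_sign (a b : C) : a ^+ 2 = b ^+ 2 -> exists2 c, c ^+ 2 = 1 & a = c * b.
Proof.
move/eqP; rewrite eqf_sqr => /orP [] /eqP ->; [exists 1|exists (-1)];
  by rewrite ?sqrrN ?expr1n ?mul1r ?mulN1r.
Qed.

(** For n even both sides of the relation equal 1 at any pair of signs. *)
Lemma mu2_homE n (a b : C) : (2 %| n)%Z -> mu2_hom n a b <-> a ^+ 2 = 1 /\ b ^+ 2 = 1.
Proof.
move=> n2; split=> [[-> -> _] //|[a2 b2]]; split=> //.
have [a0 b0] : a != 0 /\ b != 0.
  by split; [move: a2|move: b2]; apply: contra_eq_neq => ->; rewrite expr0n eq_sym oner_eq0.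
case/dvdzP: n2 => j ->; rewrite -mulNr mulrC -exprz_exp -exprnP b2 exp1rz a2.
have -> : a^-1 = a by apply: (mulfI a0); rewrite divff // -expr2.
by transitivity (a ^+ 2 * b ^+ 2); [rewrite a2 b2 mulr1|ring].
Qed.

(** The Reynolds operator of the four-element group of sign changes; it fixes invariant
    functions. *)
Definition sign_average (g : {mpoly C[3]}) (p : pt C 3) : C :=
  (peval g p + peval g (mu2_act (-1) 1 p) + peval g (mu2_act 1 (-1) p)
   + peval g (mu2_act (-1) (-1) p)) / 4.

Lemma peval3E (f : {mpoly C[3]}) : exists i j k : 'X_{1..3} -> nat, forall p : pt C 3,
  peval f p = \sum_(mm <- msupp f) f@_mm * (p`_0 ^+ i mm * p`_1 ^+ j mm * p`_2 ^+ k mm).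
Proof.
exists (fun mm => mm ord0), (fun mm => mm (lift ord0 ord0)),
  (fun mm => mm (lift ord0 (lift ord0 ord0))) => p.
rewrite /peval mevalE; apply: eq_bigr => mm _; congr (_ * _).
by rewrite !big_ord_recl big_ord0 mulr1 mulrA !(tnth_nth 0) /=.
Qed.

(* A monomial is fixed by all sign changes when its three exponents have the same
   parity, and averages to zero otherwise. *)
Lemma sign_average_sqmap (V : set (pt C 3)) (T : {poly C}) :
  (forall p, V p -> p`_0 * p`_1 * p`_2 = T.[p`_1 ^+ 2]) ->
  forall g, exists g' : {mpoly C[3]}, forall p, V p -> sign_average g p = peval g' (sqmap p).
Proof.
move=> hT g; have pc := @polyfun_coord C 3.
have mono (i j k : nat) : exists2 G : pt C 3 -> C, polyfun G & forall p, V p ->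
   (p`_0 ^+ i * p`_1 ^+ j * p`_2 ^+ k + (- p`_0) ^+ i * p`_1 ^+ j * (- p`_2) ^+ k
    + p`_0 ^+ i * (- p`_1) ^+ j * (- p`_2) ^+ k
    + (- p`_0) ^+ i * (- p`_1) ^+ j * p`_2 ^+ k) / 4 = G (sqmap p).
  (* What remains of a monomial once the even powers are removed: x y z, hence a value of [T], if
     all exponents are odd; 0 for mixed parities; 1 if all are even. *)
  pose r (q : pt C 3) := if odd i && odd j && odd k then T.[q`_1]
     else if odd i || odd j || odd k then 0 else 1.
  exists (fun q => r q * (q`_0 ^+ i./2 * q`_1 ^+ j./2 * q`_2 ^+ k./2)).
    apply: polyfunM; last by repeat apply: polyfunM; apply: polyfunX.
    by rewrite /r; case: (odd i && odd j && odd k); last (case: (_ || _));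
      [apply: polyfun_horner|apply: polyfun_cst|apply: polyfun_cst].
  move=> p Vp; rewrite /r /= -!exprM !mul2n -(hT p Vp).
  rewrite -{1 2 3 4}(odd_double_half i) -{1 2 3 4}(odd_double_half j)
    -{1 2 3 4}(odd_double_half k) !exprD.
  have sq (a : C) s : (- a) ^+ s.*2 = a ^+ s.*2 by rewrite -!mul2n !exprM sqrrN.
  rewrite !sq; case: (odd i); case: (odd j); case: (odd k);
    by rewrite /= ?expr0 ?expr1; field.
have [i [j [k gE]]] := peval3E g.
have /choice [G GE] : forall mm : 'X_{1..3}, exists Gm : pt C 3 -> C, polyfun Gm /\
   forall p, V p -> (p`_0 ^+ i mm * p`_1 ^+ j mm * p`_2 ^+ k mm
    + (- p`_0) ^+ i mm * p`_1 ^+ j mm * (- p`_2) ^+ k mm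
    + p`_0 ^+ i mm * (- p`_1) ^+ j mm * (- p`_2) ^+ k mm
    + (- p`_0) ^+ i mm * (- p`_1) ^+ j mm * p`_2 ^+ k mm) / 4 = Gm (sqmap p).
  move=> mm.
  by have [G G1 G2] := mono (i mm) (j mm) (k mm); exists G.
have [g' hg'] : polyfun (fun q => \sum_(mm <- msupp g) g@_mm * G mm q).
  apply: polyfun_sum => mm; apply: polyfunM; first exact: polyfun_cst.
  by have [] := GE mm.
exists g' => p Vp; rewrite hg' /sign_average !gE -!big_split /= mulr_suml.
apply: eq_bigr => mm _; have [_ /(_ p Vp) <-] := GE mm.
by rewrite /= !(mulN1r, mul1r, opprK); ring.
Qed.

End RationalMaps.

(** * The SL_2 and PSL_2 character varieties *)

Section CanonicalComponent.
Variables (C : numClosedFieldType) (n : int).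
Hypotheses (n_even : (2 %| n)%Z) (n_gt2 : 2 < `|n|).
Variables (hh lh : {poly C}).
Hypotheses (hhE : is_hat n (hpoly C n) hh) (lhE : is_hat n (lpoly C n) lh).

Local Notation F k y := (fpoly C k).[y].
Local Notation m := (n %/ 2)%Z.
Local Notation u y := (F (m - 1) y).
Local Notation v y := (F m y).

(* [h_n = hden * hh] and [l_n = hden * lh]. *)
Definition hden : {poly C} := if (n %% 4)%Z == 0 then 1 else 'X.

(** * The polynomials at half index, and the roots of [lh] *)

Lemma half_n : n = m * 2.
Proof. by rewrite divzK. Qed.

Lemma half_gt1 : (2 <= m) \/ (m <= -2).
Proof. by move: n_gt2; rewrite half_n; lia. Qed.

Lemma half_parity :
  ((n %% 4)%Z = 0 /\ exists j, m = j * 2) \/ ((n %% 4)%Z = 2 /\ exists j, m = j * 2 + 1).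
Proof.
have := divz_eq m 2; have := half_n; have := divz_eq n 4.
have := modz_ge0 m (isT : (2 : int) != 0); have := ltz_mod m (isT : (2 : int) != 0).
have := modz_ge0 n (isT : (4 : int) != 0); have := ltz_mod n (isT : (4 : int) != 0).
move=> h1 h2 h3 h4 h5 h6 h7.
have [e|e] : (m %% 2)%Z = 0 \/ (m %% 2)%Z = 1 by lia.
  by left; split; [lia|exists (m %/ 2)%Z; lia].
by right; split; [lia|exists (m %/ 2)%Z; lia].
Qed.

Lemma hhatE y : hden.[y] * hh.[y] = u y.
Proof.
rewrite -hornerM -/(hpoly C n) /hden; case: half_parity => [[e _]|[e _]]; rewrite e /=.
  by rewrite mul1r (proj1 hhE e).
by rewrite (proj2 hhE e).
Qed.

Lemma lhat_poly : hden * lh = fpoly C (m + 1) - fpoly C (m - 1).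
Proof.
rewrite -/(lpoly C n) /hden; case: half_parity => [[e _]|[e _]]; rewrite e /=.
  by rewrite mul1r (proj1 lhE e).
by rewrite (proj2 lhE e).
Qed.

Lemma lhatE y : hden.[y] * lh.[y] = y * v y - 2 * u y.
Proof. by rewrite -hornerM lhat_poly hornerD hornerN fval_succ; ring. Qed.

(* The polynomial L_{m+1}, where L_k(s + 1/s) = s^k + s^-k. *)
Definition lnext : {poly C} := fpoly C (m + 2) - fpoly C m.

Lemma lnextE y : lnext.[y] = y * (y * v y - u y) - 2 * v y.
Proof.
rewrite /lnext hornerD hornerN (_ : m + 2 = m + 1 + 1); last by ring.
by rewrite fval_succ addrK fval_succ; ring.
Qed.

Lemma uv_quad y : u y ^+ 2 + v y ^+ 2 - y * u y * v y = 1.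
Proof. exact: fval_quad. Qed.

Lemma fval_npred y : F (n - 1) y = v y ^+ 2 - u y ^+ 2.
Proof.
rewrite {1}half_n (_ : m * 2 - 1 = m + (m - 1)); last by ring.
rewrite fvalD fval_succ.
have := fval_succ (m - 1) y; rewrite subrK => e.
have -> : F (m - 1 - 1) y = y * u y - v y by rewrite e; ring.
by ring.
Qed.

Lemma fval_n y : F n y = y * v y ^+ 2 - 2 * u y * v y.
Proof.
rewrite {1}half_n (_ : m * 2 = m + m); last by ring.
by rewrite fvalD fval_succ; ring.
Qed.

Lemma fval_nsucc y : F (n + 1) y = (y * v y - u y) ^+ 2 - v y ^+ 2.
Proof.
rewrite {1}half_n (_ : m * 2 + 1 = m + (m + 1)); last by ring.
by rewrite fvalD addrK fval_succ; ring.
Qed.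

Lemma hden_cases y :
  [\/ (n %% 4)%Z = 0 /\ hden.[y] = 1, (n %% 4)%Z = 2 /\ y = 0 | hden.[y] != 0].
Proof.
rewrite /hden; case: half_parity => [[e _]|[e _]]; rewrite e /=.
  by apply: Or31; rewrite horner1.
have [->|y0] := eqVneq y 0; first by apply: Or32.
by apply: Or33; rewrite hornerX.
Qed.

Lemma v0_even : (n %% 4)%Z = 0 -> v 0 = 0.
Proof.
case: half_parity => [[_ [j mE]] _|[-> _]] //.
have := fval_opp_even j (0 : C); rewrite oppr0 mE => /eqP.
by rewrite -addr_eq0 -mulr2n mulrn_eq0 => /eqP.
Qed.

Lemma m_neq0 : m%:~R != 0 :> C.
Proof. by rewrite intr_eq0; case: half_gt1; lia. Qed.

Lemma v0_odd : (n %% 4)%Z = 2 -> u 0 = 0 /\ v 0 ^+ 2 = 1.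
Proof.
move=> e; have u0 : u 0 = 0 by rewrite -hhatE /hden e /= hornerX mul0r.
by split=> //; rewrite -(uv_quad 0) u0; ring.
Qed.

(** Here y [lh](y) is l_n, so [lh](0) is the derivative of l_n at 0, and l_n' = m f_m. *)
Lemma lhat0_odd : (n %% 4)%Z = 2 -> lh.[0] = m%:~R * v 0.
Proof.
move=> e; rewrite -deriv_fdiff -lhat_poly /hden e /= derivM derivX hornerD !hornerM.
by rewrite horner1 hornerX; ring.
Qed.

(** A common zero with [hh] has u = 0, so v^2 = 1 by the quadratic relation and y v = 2 u forces y =
    0. There v vanishes for m even, while [lh](0) = m v(0) is nonzero for m odd. *)
Lemma lhat_root y : lh.[y] = 0 -> hh.[y] != 0 /\ lnext.[y] != 0.
Proof.
move=> l0; have := lhatE y; rewrite l0 mulr0 => /esym yv.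
have q := uv_quad y; split; apply/eqP => h0.
  have u0 : u y = 0 by rewrite -hhatE h0 mulr0.
  have v2 : v y ^+ 2 = 1 by rewrite -q u0; ring.
  have v0 : v y != 0 by apply: contra_eq_neq v2 => ->; rewrite expr0n eq_sym oner_eq0.
  have y0 : y = 0.
    by move: yv; rewrite u0 mulr0 subr0 => /eqP; rewrite mulf_eq0 (negbTE v0) orbF => /eqP.
  case: half_parity => [[e _]|[e _]].
    by move: v0; rewrite y0 v0_even // eqxx.
  move: l0; rewrite y0 lhat0_odd // => /eqP; rewrite mulf_eq0 (negbTE m_neq0) /=.
  by move: v0; rewrite y0 => /negbTE ->.
move: h0; rewrite lnextE => h0.
have /eqP := oner_neq0 C; apply; rewrite -q.
(* This writes u^2 + v^2 - y u v as a combination of [lnext] and l_n, which therefore have no common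
   zero. *)
transitivity (- (1 / 2) * (v y * (y * (y * v y - u y) - 2 * v y))
  + (1 / 2) * (y * v y - u y) * (y * v y - 2 * u y)); first by field.
by rewrite h0 yv; ring.
Qed.

Lemma fval_uv2 : u 2 = m%:~R - 1 /\ v 2 = m%:~R.
Proof. by rewrite !fval2C rmorphB. Qed.

(** At y = 2 the polynomial l_n has value 2 and derivative m^2, which a constant [lh] would
    contradict since |m| > 1; so [lh] has a root r. It is simple because l_n'(r) = m v(r), and v(r)
    = 0 would force u(r) = 0 as well, against the quadratic relation. *)
Lemma lhat_simple_root : exists r, lh.[r] = 0 /\ lh^`().[r] != 0.
Proof.
have dE r : (hden * lh)^`().[r] = m%:~R * v r by rewrite lhat_poly deriv_fdiff.
have sz : size lh != 1%N.
  apply/negP => /size_poly1P [c _ lc].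
  have := lhatE 2; have := dE 2; have [-> ->] := fval_uv2.
  rewrite lc derivM derivC mulr0 addr0 hornerM !hornerC /hden.
  case: half_parity => [[-> _]|[-> _]] /=.
    rewrite -polyC1 derivC horner0 mul0r => /esym/eqP.
    by rewrite mulf_eq0 orbb (negbTE m_neq0).
  rewrite derivX horner1 mul1r hornerX => -> /eqP.
  rewrite -subr_eq0.
  have -> : 2 * (m%:~R * m%:~R) - (2 * m%:~R - 2 * (m%:~R - 1)) =
    2 * (m * m - 1)%:~R :> C by rewrite rmorphB rmorphM /=; ring.
  rewrite mulf_eq0 intr_eq0 pnatr_eq0 /=; apply/negP; case: half_gt1; nia.
have [r /rootP lr] := closed_rootP lh sz.
exists r; split=> //.
have := dE r; rewrite derivM hornerD !hornerM lr mulr0 add0r => e.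
suff : m%:~R * v r != 0 by rewrite -e mulf_eq0 negb_or => /andP [].
rewrite mulf_neq0 ?m_neq0 //; apply/eqP => v0.
have := lhatE r; rewrite lr v0 !mulr0 sub0r => /esym/eqP.
rewrite oppr_eq0 mulf_eq0 pnatr_eq0 /= => /eqP u0.
by have := uv_quad r; rewrite u0 v0 !mulr0 subr0 !expr0n addr0 => /eqP; rewrite eq_sym oner_eq0.
Qed.

Lemma lhat_neq0 : lh != 0.
Proof.
have [r [_ h]] := lhat_simple_root.
by apply: contraNneq h => ->; rewrite deriv0 horner0.
Qed.

Definition fcurve_poly : {poly C} := - hh * lh.

Lemma fcurve_polyE y : fcurve_poly.[y] = - hh.[y] * lh.[y].
Proof. by rewrite hornerM hornerN. Qed.

Lemma fcurve_simple_root : exists r, fcurve_poly.[r] = 0 /\ fcurve_poly^`().[r] != 0.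
Proof.
have [r [lr dlr]] := lhat_simple_root; exists r; rewrite fcurve_polyE lr mulr0; split=> //.
rewrite derivM hornerD !hornerM lr mulr0 add0r hornerN mulf_neq0 // oppr_eq0.
by have [] := lhat_root lr.
Qed.

Lemma hat_even y : hh.[- y] = hh.[y] /\ lh.[- y] = lh.[y].
Proof.
have [hy ly] := (hhatE y, lhatE y); have [hNy lNy] := (hhatE (- y), lhatE (- y)).
case: half_parity => [[e [j mE]]|[e [j mE]]].
  move: hy ly hNy lNy; rewrite /hden e /= !horner1 !mul1r mE => -> -> -> ->.
  have -> : j * 2 - 1 = (j - 1) * 2 + 1 by ring.
  by rewrite fval_opp_odd fval_opp_even; split=> //; ring.
have [->|y0] := eqVneq y 0; first by rewrite oppr0.
move: hy ly hNy lNy; rewrite /hden e /= !hornerX mE addrK.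
rewrite fval_opp_odd fval_opp_even => hy ly hNy lNy.
by split; apply: (mulfI y0); apply: oppr_inj; rewrite -!mulNr ?hNy ?lNy mulNr ?hy ?ly; ring.
Qed.

(** [hden] and [lnext] have opposite parities, so along the parametrisation y -> - y changes the
    sign of exactly one of x and z. *)
Lemma hden_lnext_sign (b y : C) : b ^+ 2 = 1 -> exists2 c : C, c ^+ 2 = 1 &
  hden.[b * y] = c * hden.[y] /\ lnext.[b * y] = c * b * lnext.[y].
Proof.
move/eqP; rewrite sqrf_eq1 => /orP [] /eqP ->.
  by exists 1; rewrite ?expr1n // !mul1r.
rewrite mulN1r /hden !lnextE; case: half_parity => [[e [j mE]]|[e [j mE]]]; rewrite e mE /=.
  exists 1; rewrite ?expr1n // !horner1; have -> : j * 2 - 1 = (j - 1) * 2 + 1 by ring.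
  by rewrite fval_opp_odd fval_opp_even; split; ring.
exists (-1); rewrite ?sqrrN ?expr1n // !hornerX addrK.
by rewrite fval_opp_odd fval_opp_even; split; ring.
Qed.

(** [hden] can vanish only at 0, when it is y; then m is odd and [lnext](0) = - 2 f_m(0) is
    nonzero. *)
Lemma hden_lnext_bezout : exists a b : {poly C},
  forall y, a.[y] * hden.[y] + b.[y] * lnext.[y] = 1.
Proof.
case: half_parity => [[e _]|[e _]]; rewrite /hden e /=.
  by exists 1, 0 => y; rewrite !horner1 horner0; ring.
set c := lnext.[0]; have c0 : c != 0.
  have [u0 v2] := v0_odd e; rewrite /c lnextE u0.
  have -> : 0 * (0 * v 0 - 0) - 2 * v 0 = - (2 * v 0) by ring.
  rewrite oppr_eq0 mulf_neq0 ?pnatr_eq0 //.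
  by apply: contra_eq_neq v2 => ->; rewrite expr0n eq_sym oner_eq0.
have /factor_theorem [q qE] : root (lnext - c%:P) 0.
  by rewrite rootE hornerD hornerN hornerC subrr.
exists (- c^-1 *: q), (c^-1)%:P => y.
have -> : lnext.[y] = q.[y] * y + c.
  have := congr1 (horner^~ y) qE.
  by rewrite /= hornerD hornerN hornerM hornerC !hornerE subr0 => <-; rewrite subrK.
by rewrite hornerZ hornerX hornerC; field.
Qed.

(** * The main curve: irreducibility, closedness, trace equations *)

Local Notation e := hden.
Local Notation L := lnext.
Local Notation P := fcurve_poly.
Local Notation D := (dcover fcurve_poly lh).

Definition main_param (t : C * C) : pt C 3 :=
  [tuple e.[t.1] * t.2; t.1; t.2 * L.[t.1] / lh.[t.1]].

Definition main_curve : set (pt C 3) := main_param @` D.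

Lemma main_curve_irreducible : zirreducible main_curve.
Proof.
have [r [Pr dPr]] := fcurve_simple_root.
apply: (@dcover_image_irreducible C P lh r) => //; first exact: lhat_neq0.
case=> [|[|[|//]]] _.
- by exists 0%N, (0, e) => t _; rewrite expr0 horner0 /=; ring.
- by exists 0%N, ('X, 0) => t _; rewrite expr0 horner0 hornerX /=; ring.
- by exists 1%N, (0, L) => t [_ dt]; rewrite expr1 horner0 /=; field.
Qed.

(* By the Bezout relation the coordinate [w] is a regular function on the curve. *)
Lemma main_coord : exists W : pt C 3 -> C, [/\ polyfun W,
  forall t, D t -> W (main_param t) = t.2
  & main_curve = [set p : pt C 3 | p`_0 = e.[p`_1] * W p] `&`
      ([set p : pt C 3 | p`_2 * lh.[p`_1] = W p * L.[p`_1]] `&`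
       ([set p : pt C 3 | W p ^+ 2 = P.[p`_1]] `&`
        [set p : pt C 3 | W p * p`_2 = - hh.[p`_1] * L.[p`_1]]))].
Proof.
have [a [b ab]] := hden_lnext_bezout.
exists (fun p => a.[p`_1] * p`_0 + b.[p`_1] * (p`_2 * lh.[p`_1])).
have pc := @polyfun_coord C 3.
have W0 t : D t -> a.[t.1] * (e.[t.1] * t.2) + b.[t.1] * (t.2 * L.[t.1] / lh.[t.1] * lh.[t.1]) = t.2.
  by move=> [_ l0]; rewrite divfK // -[RHS]mul1r -(ab t.1); ring.
split=> //.
  by apply: polyfunD; apply: polyfunM => //; try apply: polyfunM => //; apply: polyfun_horner.
apply/seteqP; split => [_ [t Dt <-]|p [/= h0 [/= h1 [/= h2 /= h3]]]].
  have [/= t2 l0] := Dt; do !split; rewrite /= W0 //; first by rewrite divfK.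
  by rewrite !mulrA -expr2 t2 fcurve_polyE; field.
move: h0 h1 h2 h3; move: (a.[p`_1] * p`_0 + b.[p`_1] * (p`_2 * lh.[p`_1])) => w h0 h1 h2 h3.
(* The fourth equation excludes the roots of [lh]: there w = 0, while [hh] and [lnext] are nonzero.
   So no point has to be added to close the curve. *)
have l0 : lh.[p`_1] != 0.
  apply/eqP => l0; have [hh0 L0] := lhat_root l0.
  move: h2; rewrite fcurve_polyE l0 mulr0 => /eqP; rewrite expf_eq0 /= => /eqP w0.
  by move: h3 => /eqP; rewrite w0 mul0r eq_sym mulf_eq0 oppr_eq0 (negbTE hh0) (negbTE L0).
exists (p`_1, w); first by split.
by apply: pt3_eq => //=; rewrite -h1 mulfK.
Qed.

Lemma main_curve_closed : zclosed main_curve.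
Proof.
have [W [pW _ ->]] := main_coord; have pc := @polyfun_coord C 3.
repeat apply: zclosedI; apply: zclosed_eq => //.
- by apply: polyfunM => //; apply: polyfun_horner.
- by apply: polyfunM => //; apply: polyfun_horner.
- by apply: polyfunM => //; apply: polyfun_horner.
- exact: polyfunX.
- exact: polyfun_horner.
- exact: polyfunM.
- by apply: polyfunM; [apply: polyfunN|]; apply: polyfun_horner.
Qed.

Lemma main_curve_variety : is_variety main_curve.
Proof. by split; [apply: main_curve_closed|apply: main_curve_irreducible]. Qed.

Lemma hat_products y : e.[y] * hh.[y] = u y /\ e.[y] * lh.[y] = y * v y - 2 * u y.
Proof. by rewrite hhatE lhatE. Qed.

Lemma uv_identities (y a b : C) : a ^+ 2 + b ^+ 2 - y * a * b = 1 ->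
  1 - (b ^+ 2 - a ^+ 2) = - a * (y * b - 2 * a) /\
  y - (y * b ^+ 2 - 2 * a * b) = - a * (y * (y * b - a) - 2 * b).
Proof.
move=> q; split; apply/eqP; rewrite -subr_eq0; apply/eqP.
  by transitivity (1 - (a ^+ 2 + b ^+ 2 - y * a * b)); [ring|rewrite q subrr].
by transitivity (y * (1 - (a ^+ 2 + b ^+ 2 - y * a * b))); [ring|rewrite q subrr mulr0].
Qed.

Lemma main_char_eqs t : D t ->
  char_eqs n 1 (e.[t.1] * t.2) t.1 (t.2 * L.[t.1] / lh.[t.1]).
Proof.
case: t => y w [/= w2 l0]; have q := uv_quad y.
have [hE lE] := hat_products y; have LE := lnextE y.
rewrite fcurve_polyE in w2.
rewrite /char_eqs !mul1r fval_npred fval_n fval_nsucc.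
set u' := u y in q hE lE LE *; set v' := v y in q hE lE LE *.
split.
- apply/eqP; rewrite -subr_eq0; apply/eqP.
  transitivity (w / lh.[y] * ((e.[y] * lh.[y]) * ((y * v' - u') ^+ 2 - v' ^+ 2 - 1)
     - L.[y] * (y * v' ^+ 2 - 2 * u' * v'))); first by field.
  rewrite lE LE.
  transitivity (w / lh.[y] * (y * v' - 2 * u') * (u' ^+ 2 + v' ^+ 2 - y * u' * v' - 1)).
    by ring.
  by rewrite q subrr mulr0.
- have -> : e.[y] * w * (w * L.[y] / lh.[y]) = e.[y] * w ^+ 2 * L.[y] / lh.[y] by ring.
  rewrite w2.
  have -> : e.[y] * (- hh.[y] * lh.[y]) * L.[y] / lh.[y] = - (e.[y] * hh.[y]) * L.[y] by field.
  by rewrite hE LE (proj2 (uv_identities q)).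
- rewrite exprMn w2.
  have -> : e.[y] ^+ 2 * (- hh.[y] * lh.[y]) = - (e.[y] * hh.[y]) * (e.[y] * lh.[y]) by ring.
  by rewrite hE lE (proj1 (uv_identities q)).
Qed.

(** With u = [hden] [hh], the last two equations read x^2 = - u [hden] [lh] and x z = - u [lnext]. A
    zero of [lh] forces [hden] = 0, and that case gives the z-axis. Otherwise w = x / [hden]. *)
Lemma char_eqs_main x y z : char_eqs n 1 x y z ->
  main_curve [tuple x; y; z] \/ [/\ (n %% 4)%Z = 2, x = 0 & y = 0].
Proof.
rewrite /char_eqs !mul1r => -[h1 h2 h3]; have q := uv_quad y.
have [hE lE] := hat_products y; have LE := lnextE y.
rewrite fval_npred fval_n fval_nsucc in h1 h2 h3.
move: h1 h2 h3 q hE lE LE; set u' := u y; set v' := v y => h1 h2 h3 q hE lE LE.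
have x2 : x ^+ 2 = - u' * (e.[y] * lh.[y]) by rewrite h3 lE (proj1 (uv_identities q)).
have xz : x * z = - u' * L.[y] by rewrite h2 LE (proj2 (uv_identities q)).
have special : e.[y] = 0 -> [/\ (n %% 4)%Z = 2, x = 0 & y = 0].
  move=> e0; have x0 : x = 0.
    by move/eqP: x2; rewrite e0 mul0r mulr0 expf_eq0 /= => /eqP.
  case: (hden_cases y) => [[_ e1]|[? ?]|/eqP //]; last by [].
  by move: e0; rewrite e1 => /eqP; rewrite oner_eq0.
have [l0|l0] := eqVneq lh.[y] 0.
  right; apply: special; have [hh0 L0] := lhat_root l0.
  have x0 : x = 0 by move/eqP: x2; rewrite l0 !mulr0 expf_eq0 /= => /eqP.
  move/eqP: xz; rewrite x0 mul0r eq_sym mulf_eq0 (negbTE L0) orbF oppr_eq0 -hE.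
  by rewrite mulf_eq0 (negbTE hh0) orbF => /eqP.
have [e0|e0] := eqVneq e.[y] 0; first by right; apply: special.
(* f_n = v (y v - 2 u), so this is the first equation with v cancelled. If v = 0 it comes from the
   equations for x^2 and x z, where x^2 = 2 allows x to be cancelled. *)
left; have zl : z * (e.[y] * lh.[y]) = x * L.[y].
  have [v0|v0] := eqVneq v' 0.
    have u2 : u' ^+ 2 = 1 by rewrite -q v0; ring.
    have x0 : x != 0.
      suff : x ^+ 2 = 2 * u' ^+ 2 by rewrite u2 mulr1 => h; apply: contra_eq_neq h => ->;
         rewrite expr0n eq_sym pnatr_eq0.
      by rewrite x2 lE v0; ring.
    apply: (mulfI x0); rewrite mulrA xz lE LE v0.
    transitivity (x ^+ 2 * (- y * u')); last by ring.
    by rewrite x2 lE v0; ring.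
  apply: (mulfI v0); rewrite lE LE; apply/eqP; rewrite -subr_eq0; apply/eqP.
  transitivity (- (x * ((y * v' - u') ^+ 2 - v' ^+ 2) -
       z * (y * v' ^+ 2 - 2 * u' * v') - x) + x * (u' ^+ 2 + v' ^+ 2 - y * u' * v' - 1)).
    by ring.
  by rewrite h1 q !subrr; ring.
exists (y, x / e.[y]).
  split=> //=; rewrite fcurve_polyE expr_div_n x2 -hE; field.
  by rewrite e0.
apply: pt3_eq => //=; first by rewrite mulrC divfK.
by apply: (mulIf e0); apply: (mulIf l0); rewrite -[RHS]mulrA zl; field; rewrite e0 l0.
Qed.

(** Multiplied by l_n, [kappa] depends on y alone, so it is nonzero at all but finitely many y. *)
Lemma main_kappa t : D t ->
  e.[t.1] * lh.[t.1] * kappa (e.[t.1] * t.2) t.1 (t.2 * L.[t.1] / lh.[t.1]) =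
  (t.1 ^+ 2 - 4) * F (m + 1) t.1.
Proof.
case: t => y w [/= w2 l0]; have q := uv_quad y.
have [hE lE] := hat_products y; have LE := lnextE y.
rewrite fcurve_polyE in w2; rewrite fval_succ.
set u' := u y in q hE lE LE *; set v' := v y in q hE lE LE *.
transitivity (w ^+ 2 / lh.[y] * (e.[y] * (e.[y] * lh.[y]) ^+ 2 + e.[y] * L.[y] ^+ 2
   - y * e.[y] * (e.[y] * lh.[y]) * L.[y]) + (y ^+ 2 - 4) * (e.[y] * lh.[y])).
  by rewrite /kappa; field.
rewrite w2.
transitivity (- (e.[y] * hh.[y]) * ((e.[y] * lh.[y]) ^+ 2 + L.[y] ^+ 2
   - y * (e.[y] * lh.[y]) * L.[y]) + (y ^+ 2 - 4) * (e.[y] * lh.[y])); first by field.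
rewrite hE lE LE.
transitivity (- u' * (4 - y ^+ 2) * (u' ^+ 2 + v' ^+ 2 - y * u' * v')
  + (y ^+ 2 - 4) * (y * v' - 2 * u')); first by ring.
by rewrite q; ring.
Qed.

(** * Density of the irreducible characters, and the components of X *)

Lemma polyfun_kappa : polyfun (fun p : pt C 3 => kappa p`_0 p`_1 p`_2).
Proof.
have pc := @polyfun_coord C 3.
apply: polyfunB (polyfun_cst _ _); apply: polyfunB.
  by repeat apply: polyfunD; apply: polyfunX.
by repeat apply: polyfunM.
Qed.

Lemma sl_char_mem (x y z : C) : char_eqs n 1 x y z -> kappa x y z != 0 ->
  exists A B : 'M[C]_2, [/\ sl_rep n A B, irreducible_rep A B & [tuple x; y; z] = sl_char A B].
Proof.
move=> /(char_point (expr1n _ _)) [A [B [dA dB rel irr [tA tB tAB]]]] k0.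
exists A, B; split; [split=> //|exact: irr|].
  by rewrite rel scale1r.
by rewrite /sl_char tA tB tAB.
Qed.

Lemma main_curve_sub : main_curve `<=` X_ n.
Proof.
apply: (dense_open main_curve_irreducible polyfun_kappa).
  have : lh * (('X^2 - 4%:P) * fpoly C (m + 1)) != 0.
    rewrite mulf_neq0 ?lhat_neq0 // mulf_neq0 //.
      apply/eqP => /(congr1 (horner^~ 0)); rewrite !hornerE /= => /eqP.
      by rewrite expr0n sub0r oppr_eq0 pnatr_eq0.
    apply/eqP => /(congr1 (horner^~ 2)); rewrite fval2C horner0 => /eqP.
    by rewrite intr_eq0; case: half_gt1; lia.
  move=> /nonroot_exists [y]; rewrite !hornerM !mulf_eq0 !negb_or => /andP [l0 /andP [y4 f0]].
  have Dt := dcover_point P l0.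
  exists (main_param (y, sqrtC P.[y])); first by exists (y, sqrtC P.[y]).
  have := main_kappa Dt; rewrite /= => kE.
  have : (y ^+ 2 - 4) * F (m + 1) y != 0.
    by rewrite mulf_neq0 //; move: y4; rewrite !hornerE.
  by rewrite -kE mulf_eq0 negb_or => /andP [].
move=> _ [t Dt <-] /= k0.
by have [A [B h]] := sl_char_mem (main_char_eqs Dt) k0; exists A, B.
Qed.

Lemma z_axisE : @z_axis C = [set p | p`_0 = 0] `&` [set p | p`_1 = 0].
Proof.
apply/seteqP; split => [_ [z ->] //|p [/= h0 h1]].
by exists p`_2; rewrite {1}(pt3E p) h0 h1.
Qed.

Lemma z_axis_variety : is_variety (@z_axis C).
Proof.
split.
  by rewrite z_axisE; apply: zclosedI; apply: zclosed_zero; apply: polyfun_coord.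
have -> : @z_axis C = [set p | exists2 y, (1 : {poly C}).[y] != 0 & p = [tuple 0; 0; y]].
  apply/seteqP; split => p; first by move=> [z ->]; exists z; rewrite // horner1 oner_neq0.
  by move=> [z _ ->]; exists z.
apply: line_image_irreducible; first exact: oner_neq0.
case=> [|[|[|//]]] _; exists 0%N; [exists 0|exists 0|exists 'X] => y _ /=;
  by rewrite expr0 mulr1 ?horner0 ?hornerX.
Qed.

Lemma z_axis_sub : (n %% 4)%Z = 2 -> @z_axis C `<=` X_ n.
Proof.
move=> n4; apply: (dense_open z_axis_variety.2 polyfun_kappa).
  exists [tuple 0; 0; 0]; first by exists 0.
  by rewrite /kappa /= !expr0n /= !mul0r !addr0 subr0 sub0r oppr_eq0 pnatr_eq0.
move=> _ [z ->] k0; apply: sl_char_mem k0.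
have [u0 v0] := v0_odd n4.
rewrite /char_eqs !mul1r fval_npred fval_n u0 v0.
by rewrite /=; split; ring.
Qed.

Lemma X_sub : X_ n `<=` main_curve `|` [set p | (n %% 4)%Z = 2 /\ z_axis p].
Proof.
apply: zclosure_min.
  apply: zclosedU main_curve_closed _.
  have [n4|n4] := pselect ((n %% 4)%Z = 2).
    have -> : [set p | (n %% 4)%Z = 2 /\ z_axis p] = @z_axis C.
      by apply/seteqP; split => // p [].
    by case: z_axis_variety.
  exists [set 1]; apply/seteqP; split => p /=; first by move=> [].
  by move=> /(_ 1 erefl) /eqP; rewrite /peval meval1 oner_eq0.
move=> p [A [B [[dA dB rel] irr ->]]].
have := char_eqs_irreducible dA dB (expr1n _ 2) irr; rewrite scale1r => /(_ _ rel) h.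
by case: (char_eqs_main h) => [|[n4 x0 y0]]; [left|right; split=> //; exists (\tr (A * B));
  rewrite /sl_char x0 y0].
Qed.

(** On the main curve y = 0 determines z^2, but z takes the values 0 and 1 on the axis. *)
Lemma z_axis_not_main : ~ @z_axis C `<=` main_curve.
Proof.
move=> h.
have key z : z ^+ 2 * lh.[0] ^+ 2 = P.[0] * L.[0] ^+ 2 /\ lh.[0] != 0.
  have [[y w] [/= w2 l0] [_ y0 zE]] : main_curve [tuple 0; 0; z] by apply: h; exists z.
  rewrite y0 in w2 l0 zE.
  by split=> //; rewrite -zE -w2; field.
have [e0 l0] := key 0; have [e1 _] := key 1.
move: e1; rewrite -e0 expr1n expr0n mul1r mul0r => /eqP.
by rewrite expf_eq0 (negbTE l0).
Qed.

Lemma canonical_component_eq (X0 : set (pt C 3)) (A B : 'M[C]_2) :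
  is_component (X_ n) X0 -> sl_rep n A B -> sl_discrete_faithful n A B ->
  X0 (sl_char A B) -> X0 = main_curve.
Proof.
move=> hX [dA _ _] df XAB; apply: (component_eq hX main_curve_variety main_curve_sub).
have [[_ irr] sub _] := hX.
have [|//|h] := irr.2 main_curve (@z_axis C) main_curve_closed z_axis_variety.1.
  by move=> p /sub /X_sub [|[_]]; [left|right].
have [z /(congr1 (fun p : pt C 3 => p`_0)) /= t0] := h _ XAB.
by have := sl_faithful_trace dA df; rewrite t0 eqxx.
Qed.

Lemma z_axis_component : (n %% 4)%Z = 2 -> is_component (X_ n) (@z_axis C).
Proof.
move=> n4; apply: (@is_componentI _ _ _ _ main_curve z_axis_variety (z_axis_sub n4) main_curve_closed).
  by move=> p /X_sub [|[_]]; [right|left].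
exact: z_axis_not_main.
Qed.

(** * Sign changes, the quotient and the curve of squares *)

Lemma hat_sign (b y : C) : b ^+ 2 = 1 -> hh.[b * y] = hh.[y] /\ lh.[b * y] = lh.[y].
Proof.
move/eqP; rewrite sqrf_eq1 => /orP [] /eqP ->; rewrite ?mul1r // mulN1r.
exact: hat_even.
Qed.

Lemma main_param_act (b y : C) : b ^+ 2 = 1 -> exists2 c : C, c ^+ 2 = 1 &
  forall a w, a ^+ 2 = 1 -> D (y, w) ->
    D (b * y, a * w) /\ main_param (b * y, a * w) = mu2_act (a * c) b (main_param (y, w)).
Proof.
move=> b2; have [c c2 [eE LE]] := hden_lnext_sign y b2; exists c => // a w a2 [/= w2 l0].
have [hE lE] := hat_sign y b2.
split; first by split; rewrite /= ?lE // exprMn a2 mul1r w2 !fcurve_polyE hE lE.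
apply: pt3_eq; rewrite //= ?eE ?LE ?lE; first by ring.
by field.
Qed.

Lemma main_curve_mu2 (a b : C) p : a ^+ 2 = 1 -> b ^+ 2 = 1 ->
  main_curve p -> main_curve (mu2_act a b p).
Proof.
move=> a2 b2 [[y w] Dt <-]; have [c c2 h] := main_param_act y b2.
have ac2 : (a * c) ^+ 2 = 1 by rewrite exprMn a2 c2 mulr1.
have [D'] := h (a * c) w ac2 Dt.
have -> : a * c * c = a by rewrite -mulrA -expr2 c2 mulr1.
by move=> <-; exists (b * y, a * c * w).
Qed.

Lemma sqmap_act (a b : C) p : a ^+ 2 = 1 -> b ^+ 2 = 1 -> sqmap (mu2_act a b p) = sqmap p.
Proof. by move=> a2 b2; apply: pt3_eq; rewrite /= !exprMn ?a2 ?b2 !mul1r. Qed.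

(** The product x y z is invariant under sign changes without being a polynomial in the squares. On
    the curve w^2 = - [hh] [lh] cancels the denominator and leaves - y [hden] [hh] [lnext], which is
    even in y. *)
Lemma main_xyz : exists T : {poly C}, forall p, main_curve p ->
  p`_0 * p`_1 * p`_2 = T.[p`_1 ^+ 2].
Proof.
have [|T hT] := @even_poly_sqr C (- 'X * hden * hh * L).
  move=> y; have b2 : (-1 : C) ^+ 2 = 1 by rewrite sqrrN expr1n.
  have [c c2] := hden_lnext_sign y b2; have [hE _] := hat_sign y b2.
  move: hE; rewrite mulN1r !hornerM !hornerN !hornerX => -> [-> ->].
  transitivity (c ^+ 2 * (- y * e.[y] * hh.[y] * L.[y])); first by ring.
  by rewrite c2 mul1r.
exists T => _ [[y w] [/= w2 l0] <-] /=; rewrite hT !hornerM hornerN hornerX.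
transitivity (e.[y] * y * L.[y] / lh.[y] * w ^+ 2); first by field.
by rewrite w2 fcurve_polyE; field.
Qed.

Lemma main_sign_orbit y w s z : D (y, w) -> D (s, z) -> s ^+ 2 = y ^+ 2 ->
  mu2_orbit n (main_param (y, w)) (main_param (s, z)).
Proof.
move=> Dt Ds /sqr_eq_sign [b b2 sE]; have [c c2 h] := main_param_act y b2.
have : z ^+ 2 = w ^+ 2.
  have [hE lE] := hat_sign y b2.
  by rewrite (proj1 Dt) (proj1 Ds) /= !fcurve_polyE sE hE lE.
move=> /sqr_eq_sign [a a2 zE]; have [_] := h a w a2 Dt; rewrite -sE -zE => ->.
exists (a * c), b; split=> //; apply/mu2_homE => //.
by rewrite exprMn a2 c2 mulr1.
Qed.

Lemma main_mu2_quotient : is_mu2_quotient n main_curve (@sqmap C @` main_curve).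
Proof.
split=> //.
- by move=> a b p /(mu2_homE _ _ n_even) [a2 b2]; apply: main_curve_mu2.
- move=> p q Mp Mq; split=> [|[a [b [/(mu2_homE _ _ n_even) [a2 b2] ->]]]]; last first.
    by rewrite sqmap_act.
  case: Mp Mq => [[y w] Dt <-] [[s z] Ds <-] /(congr1 (fun p : pt C 3 => p`_1)) /= ys.
  exact: main_sign_orbit.
move=> g inv; have [T hT] := main_xyz; have [g' hg'] := sign_average_sqmap hT g.
exists g' => p Mp; rewrite -hg' // /sign_average.
have sq1 : (-1 : C) ^+ 2 = 1 by rewrite sqrrN expr1n.
rewrite !inv //; first by field.
all: by apply/mu2_homE; rewrite ?expr1n.
Qed.

Definition square_curve : set (pt C 3) := @sqmap C @` main_curve.

(** Squaring removes w through w^2 = - [hh] [lh], so the image is a graph over y^2. The equations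
    have no solution where b = [lh] vanishes, because c does not vanish there. *)
Lemma square_curve_eqs : exists a b c : {poly C}, [/\ forall y, a.[y ^+ 2] = - e.[y] ^+ 2 * hh.[y] * lh.[y],
  forall y, b.[y ^+ 2] = lh.[y], forall y, c.[y ^+ 2] = - hh.[y] * L.[y] ^+ 2
  & square_curve = [set p | p`_0 = a.[p`_1]] `&` [set p | p`_2 * b.[p`_1] = c.[p`_1]]].
Proof.
have b2 : (-1 : C) ^+ 2 = 1 by rewrite sqrrN expr1n.
have evn y : [/\ e.[- y] ^+ 2 = e.[y] ^+ 2, L.[- y] ^+ 2 = L.[y] ^+ 2,
    hh.[- y] = hh.[y] & lh.[- y] = lh.[y]].
  have [hE lE] := hat_even y; have [c c2] := hden_lnext_sign y b2.
  by rewrite mulN1r => -[-> ->]; rewrite !exprMn c2 b2 !mul1r.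
have aH y : (- hden ^+ 2 * hh * lh).[y] = - e.[y] ^+ 2 * hh.[y] * lh.[y].
  by rewrite 2!hornerM hornerN horner_exp.
have cH y : (- hh * L ^+ 2).[y] = - hh.[y] * L.[y] ^+ 2.
  by rewrite hornerM hornerN horner_exp.
have [|a aE] := @even_poly_sqr C (- hden ^+ 2 * hh * lh).
  by move=> y; have [h1 _ h3 h4] := evn y; rewrite !aH h1 h3 h4.
have [|b bE] := @even_poly_sqr C lh; first by move=> y; have [] := evn y.
have [|c cE] := @even_poly_sqr C (- hh * L ^+ 2).
  by move=> y; have [_ h2 h3 _] := evn y; rewrite !cH h2 h3.
have aE' y : a.[y ^+ 2] = - e.[y] ^+ 2 * hh.[y] * lh.[y] by rewrite aE aH.
have cE' y : c.[y ^+ 2] = - hh.[y] * L.[y] ^+ 2 by rewrite cE cH.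
exists a, b, c; split=> //; apply/seteqP; split => [_ [_ [[y w] [/= w2 l0] <-] <-] /=|p [/= h1 h2]].
  by rewrite aE' bE cE' !exprMn w2 fcurve_polyE; split; [ring|field].
pose y := sqrtC p`_1; have yE : p`_1 = y ^+ 2 by rewrite sqrtCK.
rewrite yE aE' in h1; rewrite yE bE cE' in h2.
have l0 : lh.[y] != 0.
  apply/eqP => l0; have [hh0 L0] := lhat_root l0.
  move/eqP: h2; rewrite l0 mulr0 eq_sym mulf_eq0 oppr_eq0 (negbTE hh0) expf_eq0.
  by rewrite (negbTE L0).
have Dt := dcover_point fcurve_poly l0.
exists (main_param (y, sqrtC fcurve_poly.[y])); first by exists (y, sqrtC fcurve_poly.[y]).
apply: pt3_eq => //=.
- by rewrite exprMn sqrtCK h1 fcurve_polyE; ring.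
- by apply: (mulIf l0); rewrite h2 !exprMn sqrtCK fcurve_polyE; field.
Qed.

Lemma square_curve_variety : is_variety square_curve.
Proof.
have pc := @polyfun_coord C 3; split.
  have [a [b [c [_ _ _ ->]]]] := square_curve_eqs.
  apply: zclosedI; apply: zclosed_eq => //; try exact: polyfun_horner.
  by apply: polyfunM => //; apply: polyfun_horner.
apply: zirreducible_image main_curve_irreducible.
case=> [|[|[|i]]] /=; try exact: polyfunX.
have [f hf] := polyfun_cst 3 (0 : C); exists f => p.
by rewrite hf nth_nil.
Qed.

Lemma square_curve_birational : birational square_curve (@affine_line C).
Proof.
have [a [b [c [aE bE cE VE]]]] := square_curve_eqs.
apply: (@birational_graph C _ b a c square_curve_variety).
- apply/eqP => b0; have := lhat_neq0; case/eqP; apply: poly_fun_inj => y.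
  by rewrite -bE b0 !horner0.
- by move=> y b0; rewrite VE; split=> //=; rewrite divfK.
- by rewrite VE => p [/= h1 h2] b0; apply: pt3_eq => //=; rewrite -h2 mulfK.
Qed.

(** * The curve F and the action on the z-axis *)

Lemma Fcurve_variety : is_variety (Fcurve hh lh).
Proof.
have pc := @polyfun_coord C 2; split.
  apply: zclosed_eq; first exact: polyfunX.
  by apply: polyfunM; [apply: polyfunN|]; apply: polyfun_horner.
have -> : Fcurve hh lh = (fun t => [tuple t.1; t.2]) @` dcover fcurve_poly 1.
  apply/seteqP; split => [p /= h|_ [t [/= h _] <-]]; last by rewrite /Fcurve /= h fcurve_polyE.
  exists (p`_0, p`_1); last by rewrite -pt2E.
  by split; rewrite /= ?fcurve_polyE ?horner1 ?oner_neq0.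
have [r [Pr dPr]] := fcurve_simple_root.
apply: (@dcover_image_irreducible C fcurve_poly 1 r) => //; first exact: oner_neq0.
case=> [|[|//]] _; exists 0%N; [exists ('X, 0)|exists (0, 1)] => t _ /=.
  by rewrite hornerX horner0; ring.
by rewrite horner1 horner0; ring.
Qed.

Lemma Fcurve_birational : exists phi : ratmap C 3 2,
  [/\ birational_map phi main_curve (Fcurve hh lh),
      forall r, Fcurve hh lh r -> Fcurve hh lh (F_hyp r) /\ Fcurve hh lh (F_neg r)
    & forall p q, rdom phi main_curve p -> rdom phi main_curve q ->
        (mu2_orbit n p q <-> F_identified (reval phi p) (reval phi q))].
Proof.
have [W [pW WE _]] := main_coord.
have [phi [phid phiE]] := ratmap2 (@polyfun_coord C 3 1) pW (polyfun_cst 3 1).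
have phi' t : D t -> reval phi (main_param t) = [tuple t.1; t.2].
  by move=> Dt; rewrite phiE WE //= !divr1.
have pc := @polyfun_coord C 2; have ph q := polyfun_horner q (pc 0%N).
have [psi [psid psiE]] := ratmap3 (polyfunM (ph hden) (polyfunM (pc 1%N) (ph lh)))
  (polyfunM (pc 0%N) (ph lh)) (polyfunM (pc 1%N) (ph L)) (ph lh).
have psi' t : D t -> reval psi [tuple t.1; t.2] = main_param t.
  by move=> [_ l0]; rewrite psiE /= mulrA !mulfK.
have FD q : rdom psi (Fcurve hh lh) q -> exists2 t, D t & q = [tuple t.1; t.2].
  move=> [Fq]; rewrite psid => l0; exists (q`_0, q`_1); last exact: pt2E.
  by split=> //=; rewrite fcurve_polyE.
have DF t : D t -> rdom psi (Fcurve hh lh) [tuple t.1; t.2].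
  by move=> [t2 l0]; split; rewrite ?psid // /Fcurve /= -fcurve_polyE.
exists phi; split.
- apply: (@birational_mapI _ _ _ phi psi) main_curve_variety Fcurve_variety _ _ _ _ _.
  + by move=> _ [[t Dt <-] _]; rewrite phi' //; case: (DF t Dt).
  + by move=> _ /FD [t Dt ->]; rewrite psi' //; exists t.
  + by move=> _ [[t Dt <-] _] _; rewrite phi' // psi'.
  + by move=> _ /FD [t Dt ->] _; rewrite psi' // phi'.
  + have [y l0] := nonroot_exists lhat_neq0.
    have Dt := dcover_point fcurve_poly l0.
    exists (main_param (y, sqrtC fcurve_poly.[y])).
      by split; [exists (y, sqrtC fcurve_poly.[y])|rewrite phid oner_neq0].
    by rewrite phi' //; apply: DF.
- move=> r; rewrite /Fcurve /= sqrrN => Fr; split=> //.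
  by have [-> ->] := hat_even r`_0.
- move=> _ _ [[[y w] Dt <-] _] [[[s z] Ds <-] _]; rewrite !phi' //; split.
    move=> [a [b [/(mu2_homE _ _ n_even) [a2 b2] E]]]; apply/F_identifiedP => /=.
    have sE := congr1 (fun p : pt C 3 => p`_1) E; rewrite /= in sE.
    have : z ^+ 2 = w ^+ 2.
      have [hE lE] := hat_sign y b2.
      by rewrite (proj1 Dt) (proj1 Ds) /= !fcurve_polyE sE hE lE.
    by move=> /sqr_eq_sign [c c2 zE]; exists b, c; rewrite sE zE.
  move=> /F_identifiedP [b [c [b2 c2 /= E]]].
  have sE := congr1 (fun p : pt C 2 => p`_0) E; rewrite /= in sE.
  by apply: main_sign_orbit => //; rewrite sE exprMn b2 mul1r.
Qed.

(** On the axis a pair of signs acts only through its product, as z -> z or z -> - z. *)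
Lemma z_axis_involution : (n %% 4)%Z = 2 ->
  exists j : pt C 3 -> pt C 3,
    [/\ forall p, z_axis p -> z_axis (j p), forall p, z_axis p -> j (j p) = p,
        exists2 p, z_axis p & j p <> p
      & forall p q, z_axis p -> z_axis q -> (mu2_orbit n p q <-> q = p \/ q = j p)].
Proof.
move=> n4; exists (mu2_act (-1) 1).
have sq1 : (-1 : C) ^+ 2 = 1 by rewrite sqrrN expr1n.
have actE (a b z : C) : mu2_act a b [tuple 0; 0; z] = [tuple 0; 0; a * b * z].
  by apply: pt3_eq; rewrite //= mulr0.
split.
- by move=> _ [z ->]; rewrite actE; exists (-1 * 1 * z).
- by move=> _ [z ->]; rewrite !actE; apply: pt3_eq => //=; ring.
- exists [tuple 0; 0; 1]; first by exists 1.
  rewrite actE => /(congr1 (fun p : pt C 3 => p`_2)) /= /eqP.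
  by rewrite !mulr1 -subr_eq0 -opprD oppr_eq0 -mulr2n pnatr_eq0.
move=> _ _ [z ->] [z' ->]; rewrite actE; split.
  move=> [a [b [/(mu2_homE _ _ n_even) [a2 b2] ->]]]; rewrite actE.
  have : (a * b) ^+ 2 == 1 by rewrite exprMn a2 b2 mulr1.
  rewrite sqrf_eq1 => /orP [] /eqP ->; [left|right]; apply: pt3_eq => //=; ring.
case=> ->; [exists 1, 1|exists (-1), 1]; (split; last by rewrite actE ?mulr1 ?mul1r);
  by apply/mu2_homE; rewrite ?expr1n.
Qed.

(** * Representations that do not lift *)

Variables q1 q2 q3 : {poly C}.
Hypotheses (q1E : q1 \Po 'X^2 = fpoly C (n - 1) + 1)
  (q2E : q2 \Po 'X^2 = (fpoly C n + 'X) ^+ 2)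
  (q3E : q3 \Po 'X^2 = fpoly C (n - 1) + 1).

Local Notation N := (nl_curve q1 q2 q3).
Local Notation xz_zero := ([set p : pt C 3 | p`_0 = 0] `&` [set p : pt C 3 | p`_2 = 0]).

Lemma horner_comp_sqr (p : {poly C}) y : (p \Po 'X^2).[y] = p.[y ^+ 2].
Proof. by rewrite horner_comp hornerXn. Qed.

Lemma q1_sqr y : q1.[y ^+ 2] = F (n - 1) y + 1.
Proof. by rewrite -horner_comp_sqr q1E hornerD horner1. Qed.

Lemma q2_sqr y : q2.[y ^+ 2] = (y + F n y) ^+ 2.
Proof. by rewrite -horner_comp_sqr q2E horner_exp hornerD hornerX addrC. Qed.

Lemma q3_sqr y : q3.[y ^+ 2] = F (n - 1) y + 1.
Proof. by rewrite -horner_comp_sqr q3E hornerD horner1. Qed.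

Lemma n_neq0 : n%:~R != 0 :> C.
Proof. by rewrite intr_eq0; apply/eqP => n0; move: n_gt2; rewrite n0. Qed.

(** The sample point y = 2, where f_k(2) = k makes everything explicit; it serves to show that [q3]
    is nonzero and to tell components apart. *)
Lemma q_at4 : [/\ q1.[4] = n%:~R, q2.[4] = (n%:~R + 2) ^+ 2 & q3.[4] = n%:~R].
Proof.
have -> : 4 = 2 ^+ 2 :> C by ring.
rewrite q1_sqr q2_sqr q3_sqr !fval2C rmorphB /=.
by split; ring.
Qed.

Lemma q3_neq0 : q3 != 0.
Proof.
by apply/eqP => h; have [_ _] := q_at4; rewrite h horner0 => /esym/eqP; rewrite (negbTE n_neq0).
Qed.

Lemma nl_curve_irreducible : zirreducible N.
Proof.
apply: line_image_irreducible; first exact: q3_neq0.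
case=> [|[|[|//]]] _; [exists 0%N, q1|exists 0%N, 'X|exists 1%N, q2] => y y0 /=.
- by rewrite expr0 mulr1.
- by rewrite expr0 mulr1 hornerX.
- by rewrite expr1 divfK.
Qed.

Lemma nl_closure_variety : is_variety (zclosure N).
Proof.
split; first exact: zclosure_closed.
exact: zirreducible_closure nl_curve_irreducible.
Qed.

Lemma nl_closure_eqs p : zclosure N p -> p`_0 = q1.[p`_1] /\ p`_2 * q3.[p`_1] = q2.[p`_1].
Proof.
have pc := @polyfun_coord C 3; have ph q := polyfun_horner q (pc 1%N).
apply: (@zclosure_min C 3 N ([set p : pt C 3 | p`_0 = q1.[p`_1]] `&`
  [set p : pt C 3 | p`_2 * q3.[p`_1] = q2.[p`_1]])).
  by apply: zclosedI; apply: zclosed_eq => //; apply: polyfunM.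
by move=> _ [y y0 ->]; split=> //=; rewrite divfK.
Qed.

Lemma nl_closure_birational : birational (zclosure N) (@affine_line C).
Proof.
apply: (@birational_graph C _ q3 q1 q2 nl_closure_variety q3_neq0).
  by move=> y y0; apply: sub_zclosure; exists y.
move=> p /nl_closure_eqs [h0 h2] y0.
by apply: pt3_eq => //=; rewrite -h2 mulfK.
Qed.

Lemma char_eqs_opp (c x y z : C) : char_eqs n c x y z -> char_eqs n c x (- y) (- z).
Proof.
rewrite /char_eqs => -[h1 h2 h3].
have nE := half_n.
have E1 : F (n + 1) (- y) = F (n + 1) y by rewrite nE fval_opp_odd.
have E2 : F n (- y) = - F n y by rewrite nE fval_opp_even.
have E3 : F (n - 1) (- y) = F (n - 1) y.
  by rewrite nE (_ : m * 2 - 1 = (m - 1) * 2 + 1); [rewrite fval_opp_odd|ring].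
by rewrite E1 E2 E3; split; [rewrite -h1|rewrite mulrN h2|rewrite h3]; ring.
Qed.

(** The symmetry [char_eqs_opp] allows the square root y of the second coordinate to be
    prescribed. *)
Lemma square_curve_char p y : square_curve p -> y ^+ 2 = p`_1 ->
  exists x z, [/\ char_eqs n 1 x y z, x ^+ 2 = p`_0 & z ^+ 2 = p`_2].
Proof.
move=> [_ [t Dt <-] <-] /= /eqP; have h := main_char_eqs Dt.
rewrite eqf_sqr => /orP [] /eqP ->; first by exists (e.[t.1] * t.2), (t.2 * L.[t.1] / lh.[t.1]).
exists (e.[t.1] * t.2), (- (t.2 * L.[t.1] / lh.[t.1])).
by rewrite sqrrN; split=> //; apply: char_eqs_opp.
Qed.

Lemma fval_of_pow k (s c : C) : s != 0 -> s ^+ 2 != 1 -> s ^ k = c ->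
  F k (s + s^-1) = (c - c^-1) / (s - s^-1) /\ s - s^-1 != 0.
Proof.
move=> s0 s2 sk; have d0 : s - s^-1 != 0.
  apply: contra_neq s2 => h; have -> : s ^+ 2 = s * (s - s^-1) + 1 by field.
  by rewrite h mulr0 add0r.
split=> //; apply: (mulIf d0); rewrite divfK // fpow_sub // sk.
by rewrite -invr_expz sk.
Qed.

Lemma pow_n_neg1 (s : C) j : (2 %| j)%Z -> s ^ j = -1 -> s != 0 /\ s ^+ 2 != 1.
Proof.
move=> /dvdzP [i jE] sj; have n1 : (1 : C) != -1.
  by rewrite -subr_eq0 opprK -mulr2n pnatr_eq0.
split; apply/eqP => h.
  move: sj; rewrite h exp0rz; case: (_ == _) => /eqP; rewrite ?(negbTE n1) //.
  by rewrite eq_sym oppr_eq0 oner_eq0.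
by move: sj => /eqP; rewrite jE mulrC -exprz_exp -exprnP h exp1rz (negbTE n1).
Qed.

(** From s^n = -1 follow f_n = 0 and f_{n-1} = 1, so q1 = q3 = 2 and q2 = y^2: these points lie on
    the parametrised curve. *)
Lemma nl_points1_sub : nl_points1 n `<=` N.
Proof.
have n0 : n != 0 by move: n_neq0; rewrite intr_eq0.
move=> _ [yb /(sqset_Rfib_diff _ n0 n_even) [s sn ->] ->].
have [s0 s2] := pow_n_neg1 n_even sn.
have [Fn d0] := fval_of_pow s0 s2 sn.
have sn1 : s ^ (n - 1) = - s^-1 by rewrite expfzDr // sn exprN1 mulN1r.
have [Fn1 _] := fval_of_pow s0 s2 sn1.
have {}Fn : F n (s + s^-1) = 0 by rewrite Fn invrN1 opprK addNr mul0r.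
have {}Fn1 : F (n - 1) (s + s^-1) = 1.
  by rewrite Fn1 invrN invrK opprK addrC divff.
exists ((s + s^-1) ^+ 2); rewrite ?q1_sqr ?q2_sqr ?q3_sqr Fn1 ?Fn ?addr0 //.
by rewrite -mulr2n pnatr_eq0.
Qed.

Lemma n2_neq0 : n - 2 != 0.
Proof. by apply/eqP => h; move: n_gt2; rewrite (subr0_eq h). Qed.

Lemma n2_even : (2 %| n - 2)%Z.
Proof. by rewrite rpredB. Qed.

(** With x = z = 0 and sign -1 the equations say f_n = - y and f_{n-1} = -1, which for y = s + s^-1
    amounts to s^(n-2) = -1. *)
Lemma nl_points2P p : nl_points2 n p <->
  exists2 y : C, char_eqs n (-1) 0 y 0 /\ y ^+ 2 != 4 & p = [tuple 0; y ^+ 2; 0].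
Proof.
split.
  move=> [yb /(sqset_Rfib_diff _ n2_neq0 n2_even) [s sn ->] ->].
  have [s0 s2] := pow_n_neg1 n2_even sn.
  have sn0 : s ^ n = - s ^+ 2.
    by rewrite -[n](subrK 2) expfzDr // sn mulN1r.
  have sn1 : s ^ (n - 1) = - s by rewrite expfzDr // sn0 exprN1 expr2 mulNr mulfK.
  have [Fn d0] := fval_of_pow s0 s2 sn0; have [Fn1 _] := fval_of_pow s0 s2 sn1.
  have s21 : s ^+ 2 - 1 != 0 by rewrite subr_eq0.
  exists (s + s^-1) => //; split; last first.
    rewrite -subr_eq0 (_ : _ - 4 = (s - s^-1) ^+ 2); last by field.
    by rewrite expf_eq0.
  split; rewrite ?mul0r ?mulr0 ?subr0 // ?Fn ?Fn1; first by field; rewrite ?s0 ?s21.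
  by rewrite expr0n /=; field; rewrite ?s0 ?s21.
move=> [y [[_ h2 h3] y4] ->]; exists (y ^+ 2) => //.
apply/(sqset_Rfib_diff _ n2_neq0 n2_even).
have [s s0 yE] := trace_root y; exists s; last by rewrite yE.
have Fn : F n y = - y by move/eqP: h2; rewrite mul0r mulN1r opprK eq_sym addrC addr_eq0 => /eqP.
have Fn1 : F (n - 1) y = -1.
  by move/eqP: h3; rewrite expr0n mulN1r opprK eq_sym addrC addr_eq0 => /eqP.
rewrite expfzDr // fpow // -yE Fn Fn1 yE -exprnN; field.
by [].
Qed.

Lemma mod4_of_fval0 : F (n - 1) 0 = -1 -> (n %% 4)%Z = 0.
Proof.
case: half_parity => [[-> //]|[n4 _]].
have [u0 v0] := v0_odd n4; rewrite fval_npred v0 u0 expr0n subr0 => /eqP.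
by rewrite -subr_eq0 opprK -mulr2n pnatr_eq0.
Qed.

(** If x is nonzero, x z = y + f_n determines z and the point is on the curve. If x = 0, then f_n =
    - y and the first equation becomes z y = 0: either y = 0 or z = 0. *)
Lemma neg_char_cases (x y z : C) : char_eqs n (-1) x y z ->
  [\/ N [tuple x ^+ 2; y ^+ 2; z ^+ 2], nl_points2 n [tuple x ^+ 2; y ^+ 2; z ^+ 2]
    | (n %% 4)%Z = 0 /\ z_axis [tuple x ^+ 2; y ^+ 2; z ^+ 2]].
Proof.
move=> h; have [h1 h2 h3] := h; rewrite !mulN1r !opprK in h1 h2 h3.
have [x0|x0] := eqVneq x 0; last first.
  have q0 : F (n - 1) y + 1 = x ^+ 2 by rewrite h3 addrC.
  apply: Or31; exists (y ^+ 2); rewrite ?q1_sqr ?q2_sqr ?q3_sqr q0 ?expf_neq0 //.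
  by apply: pt3_eq => //=; rewrite -h2; field.
rewrite x0 in h h1 h2 h3 *; rewrite mul0r in h2.
have Fn : F n y = - y by move/esym/eqP: h2; rewrite addrC addr_eq0 => /eqP.
have [y0|y0] := eqVneq y 0.
  apply: Or33; split; last by exists (z ^+ 2); rewrite y0 !expr0n.
  apply: mod4_of_fval0; move/esym/eqP: h3; rewrite y0 expr0n addrC addr_eq0.
  by move/eqP.
have z0 : z = 0.
  move/eqP: h1; rewrite mul0r sub0r oppr0 oppr_eq0 Fn mulrN oppr_eq0 mulf_eq0.
  by rewrite (negbTE y0) orbF => /eqP.
rewrite z0 in h *; apply: Or32; rewrite expr0n /=.
have [s s0 yE] := trace_root y.
exists (y ^+ 2) => //; apply/(sqset_Rfib_diff _ n2_neq0 n2_even).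
exists s; last by rewrite yE.
have Fn1 : F (n - 1) y = -1.
  by move/esym/eqP: h3; rewrite expr0n addrC addr_eq0 => /eqP.
rewrite expfzDr // fpow // -yE Fn Fn1 yE -exprnN; field.
by [].
Qed.

Lemma nl_curve_char y : q3.[y] != 0 -> exists x' y' z', char_eqs n (-1) x' y' z' /\
  [tuple q1.[y]; y; q2.[y] / q3.[y]] = [tuple x' ^+ 2; y' ^+ 2; z' ^+ 2] :> pt C 3.
Proof.
have -> : y = sqrtC y ^+ 2 by rewrite sqrtCK.
set y' := sqrtC y; rewrite q1_sqr q2_sqr q3_sqr => q0.
pose x := sqrtC (F (n - 1) y' + 1); have x2 : x ^+ 2 = F (n - 1) y' + 1 by rewrite sqrtCK.
have x0 : x != 0 by apply: contraNneq q0 => x0; rewrite -x2 x0 expr0n.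
exists x, y', ((y' + F n y') / x); split; last by rewrite x2 expr_div_n x2.
split.
- apply: (mulfI x0); transitivity (x ^+ 2 * F (n + 1) y' - (y' + F n y') * F n y').
    by field.
  have := fval_quad n y'; have := fval_succ n y'; rewrite mulrCA -expr2 x2.
  move=> -> q; set a := F (n - 1) y' in q *; set b := F n y' in q *.
  (* Multiplied by x, the first equation follows from the other two and the quadratic relation
     between f_{n-1} and f_n. *)
  transitivity (- (1 + a) + (1 - (a ^+ 2 + b ^+ 2 - y' * a * b))); first by ring.
  by rewrite q; ring.
- by rewrite mulrC divfK //; ring.
- by rewrite x2; ring.
Qed.

Lemma psl_char_mem (x y z : C) : char_eqs n (-1) x y z -> kappa x y z != 0 ->
  Y_ n [tuple x ^+ 2; y ^+ 2; z ^+ 2].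
Proof.
move=> /(char_point _) [|A [B [dA dB rel irr [tA tB tAB]]] k0].
  by rewrite sqrrN expr1n.
apply: sub_zclosure; exists A, B; split; [split=> //; right|exact: irr|].
  by rewrite rel scaleN1r.
by rewrite /psl_char tA tB tAB.
Qed.

(* Insensitive to the signs of the three traces. *)
Definition kappa_sqr (p : pt C 3) : C := (p`_0 + p`_1 + p`_2 - 4) ^+ 2 - p`_0 * p`_1 * p`_2.

(** The second factor is [kappa] at (x, y, - z): the two factors are the values of [kappa] under all
    sign changes. *)
Lemma kappa_sqrE (x y z : C) : kappa_sqr [tuple x ^+ 2; y ^+ 2; z ^+ 2] =
  kappa x y z * (x ^+ 2 + y ^+ 2 + z ^+ 2 + x * y * z - 4).
Proof. by rewrite /kappa_sqr /kappa /=; ring. Qed.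

Lemma kappa_sqr_neq0 (x y z : C) :
  kappa_sqr [tuple x ^+ 2; y ^+ 2; z ^+ 2] != 0 -> kappa x y z != 0.
Proof. by rewrite kappa_sqrE mulf_eq0 negb_or => /andP []. Qed.

Lemma polyfun_kappa_sqr : polyfun kappa_sqr.
Proof.
have pc := @polyfun_coord C 3; apply: polyfunB; last by repeat apply: polyfunM.
apply: polyfunX; apply: polyfunB (polyfun_cst _ _); by repeat apply: polyfunD.
Qed.

Lemma nl_curve_at4 : exists2 p, N p & [/\ p`_0 = n%:~R, p`_1 = 4 & kappa_sqr p != 0].
Proof.
have [q14 q24 q34] := q_at4; have n0 := n_neq0.
exists [tuple q1.[4]; 4; q2.[4] / q3.[4]]; first by exists 4; rewrite ?q34.
split=> //; rewrite /kappa_sqr /= q14 q24 q34.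
have -> : (n%:~R + 4 + (n%:~R + 2) ^+ 2 / n%:~R - 4) ^+ 2 -
    n%:~R * 4 * ((n%:~R + 2) ^+ 2 / n%:~R) = 16 * ((n + 1)%:~R ^+ 2) / n%:~R ^+ 2 :> C.
  by rewrite rmorphD /=; field.
rewrite mulf_neq0 ?invr_eq0 ?expf_neq0 // mulf_neq0 ?pnatr_eq0 // expf_neq0 // intr_eq0.
by apply/eqP => h; move: n_gt2; have -> : n = -1 by lia.
Qed.

Lemma nl_closure_sub : zclosure N `<=` Y_ n.
Proof.
apply: zclosure_min; first exact: zclosure_closed.
have := dense_open nl_curve_irreducible polyfun_kappa_sqr.
move=> /(_ (Y_ n)) h p Np.
have : zclosure (Y_ n) p.
  apply: h Np; first by have [p' h1 [_ _ h2]] := nl_curve_at4; exists p'.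
  move=> _ [y y0 ->]; have [x [y' [z [eqs ->]]]] := nl_curve_char y0.
  by move=> /kappa_sqr_neq0; apply: psl_char_mem.
by apply: zclosure_min => //; apply: zclosure_closed.
Qed.

Lemma z_axis_neg_char (z : C) : (n %% 4)%Z = 0 -> char_eqs n (-1) 0 0 z.
Proof.
move=> n4; have v0 := v0_even n4; have := uv_quad 0; rewrite v0 => q.
have u2 : u 0 ^+ 2 = 1 by rewrite -q; ring.
by rewrite /char_eqs fval_npred fval_n u2 v0; split; ring.
Qed.

Lemma z_axis_sub_Y : (n %% 4)%Z = 0 -> @z_axis C `<=` Y_ n.
Proof.
move=> n4 p zp; have : zclosure (Y_ n) p.
  apply: (dense_open z_axis_variety.2 polyfun_kappa_sqr) zp.
    exists [tuple 0; 0; 0]; first by exists 0.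
    by rewrite /kappa_sqr /= !addr0 sub0r !mulr0 subr0 sqrrN expf_neq0 // pnatr_eq0.
  move=> _ [z ->].
  have -> : [tuple 0; 0; z] = [tuple 0 ^+ 2; 0 ^+ 2; sqrtC z ^+ 2] :> pt C 3.
    by rewrite sqrtCK !expr0n.
  by move=> /kappa_sqr_neq0; apply: psl_char_mem; apply: z_axis_neg_char.
by apply: zclosure_min => //; apply: zclosure_closed.
Qed.

(** A polynomial vanishing on the characters generating Y, composed with [sqmap], vanishes on those
    generating X, hence on the main curve. *)
Lemma square_curve_sub : square_curve `<=` Y_ n.
Proof.
move=> _ [p /main_curve_sub Xp <-] f hf.
have [g hg] : polyfun (fun p => peval f (sqmap p)).
  apply: polyfun_comp; case=> [|[|[|i]]] /=; try exact/polyfunX/polyfun_coord.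
  by have [g hg] := polyfun_cst 3 (0 : C); exists g => q; rewrite hg nth_nil.
rewrite -hg; apply: Xp => _ [A [B [[dA dB rel] irr ->]]]; rewrite hg; apply: hf.
by exists A, B; split=> //; split=> //; left.
Qed.

Lemma xz_zero_closed : zclosed xz_zero.
Proof. by apply: zclosedI; apply: zclosed_zero; apply: polyfun_coord. Qed.

(** A deliberate overestimate: the isolated points are replaced by the closed line x = z = 0, which
    contains none of the components to be identified. *)
Lemma Y_sub : Y_ n `<=` square_curve `|` (zclosure N `|` (@z_axis C `|` xz_zero)).
Proof.
have zc := z_axis_variety.1; have sc := square_curve_variety.1.
apply: zclosure_min.
  by apply: zclosedU => //; apply: zclosedU; [apply: zclosure_closed|apply: zclosedU xz_zero_closed].
move=> p [A [B [[dA dB rel] irr ->]]].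
have [rel'|rel'] := rel.
  have := char_eqs_irreducible dA dB (expr1n _ 2) irr; rewrite scale1r => /(_ _ rel') h.
  case: (char_eqs_main h) => [h'|[n4 x0 y0]]; first by left; exists (sl_char A B).
  right; right; left; exists (\tr (A * B) ^+ 2).
  by rewrite /psl_char x0 y0 expr0n.
have sq1 : (-1 : C) ^+ 2 = 1 by rewrite sqrrN expr1n.
have := char_eqs_irreducible dA dB sq1 irr; rewrite scaleN1r => /(_ _ rel') h.
right; case: (neg_char_cases h) => [h'|/nl_points2P [y _ yE]|[_ h']].
- by left; apply: sub_zclosure.
- by right; right; rewrite /psl_char yE.
- by right; left.
Qed.

(** From b^n = c b^-2 one gets f_{n+j} = c f_{j-2} by [fpow_sub]; these are the cases j = -1, 0,
    1. *)
Lemma reducible_fvals (b c : C) : b != 0 -> c ^+ 2 = 1 -> b ^ (- n) = c * b ^+ 2 ->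
  b ^+ 2 != 1 -> let y := b + b^-1 in
  [/\ F (n - 1) y = c * (1 - y ^+ 2), F n y = - (c * y) & F (n + 1) y = - c].
Proof.
move=> b0 c2 bn b21 y.
have c0 : c != 0 by apply: contra_eq_neq c2 => ->; rewrite expr0n eq_sym oner_eq0.
have ci : c^-1 = c by apply: (mulfI c0); rewrite divff // -expr2.
have b2 : b ^+ 2 != 0 by rewrite expf_neq0.
have bn0 : b ^ n = c * b ^- 2 by rewrite -[n]opprK -invr_expz bn invfM ci.
have bnp : b ^ (n - 1) = c * b ^- 3 by rewrite expfzDr // bn0 exprN1; field.
have bns : b ^ (n + 1) = c * b^-1 by rewrite expfzDr // bn0 expr1z; field.
have [E0 d0] := fval_of_pow b0 b21 bn0.
have [Ep _] := fval_of_pow b0 b21 bnp; have [Es _] := fval_of_pow b0 b21 bns.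
have b2' : b ^+ 2 - 1 != 0 by rewrite subr_eq0.
rewrite !invfM ci in E0 Ep Es.
by rewrite /y E0 Ep Es; split; field; rewrite ?b0 ?b2'.
Qed.

Lemma sqr_trace_sub4 (b : C) : b != 0 -> (b + b^-1) ^+ 2 = 4 -> b ^+ 2 = 1.
Proof.
move=> b0 h; have : (b - b^-1) ^+ 2 = 0 by rewrite (_ : _ ^+ 2 = (b + b^-1) ^+ 2 - 4);
  [rewrite h subrr|field].
move/eqP; rewrite expf_eq0 /= subr_eq0 => /eqP e1.
by rewrite expr2 {2}e1 divff.
Qed.

Lemma expz_n_of_sqr1 (b : C) : b ^+ 2 = 1 -> b ^ (- n) = 1.
Proof. by move=> b2; rewrite half_n -mulNr mulrC -exprz_exp -exprnP b2 exp1rz. Qed.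

(** The four pieces of [Y_sub] are examined. On the squared main curve the equations for c = 1 would
    hold at a y whose f-values come from c = -1, which leads to 2 = 4 or 2 = 0. On the line x = z =
    0, [kappa] = 0 gives y^2 = 4, so b^2 = 1, against b^-n = - b^2. The other two pieces are the
    conclusion. *)
Lemma reducible_nonlifting A B : \det A = 1 -> \det B = 1 ->
  B ^ (- n) = -1 *: rel_word A B -> ~ irreducible_rep A B -> Y_ n (psl_char A B) ->
  N (psl_char A B) \/ ((n %% 4)%Z = 0 /\ z_axis (psl_char A B)).
Proof.
move=> dA dB rel nirr; have [a [b [eig /(_ _ rel) bn]]] := reducible_eigen_pair n dA dB nirr.
have k0 := eigen_pair_kappa eig; have [a0 b0 [_ yE _]] := eig.
rewrite /psl_char; move: (\tr A) (\tr B) (\tr (A * B)) yE k0 {eig rel nirr} => x y z yE k0.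
have sq1 : (-1 : C) ^+ 2 = 1 by rewrite sqrrN expr1n.
have n1 : (1 : C) != -1 by rewrite -subr_eq0 opprK -mulr2n pnatr_eq0.
have b21 : b ^+ 2 != 1.
  apply/eqP => b2; move/eqP: bn; rewrite expz_n_of_sqr1 // b2 mulr1.
  by rewrite (negbTE n1).
have [Fp F0 Fs] := reducible_fvals b0 sq1 bn b21; rewrite -yE in Fp F0 Fs.
have {}Fp : F (n - 1) y = y ^+ 2 - 1 by rewrite Fp; ring.
have {}F0 : F n y = y by rewrite F0; ring.
have {}Fs : F (n + 1) y = 1 by rewrite Fs; ring.
have axis : x = 0 -> y = 0 ->
    (n %% 4)%Z = 0 /\ z_axis [tuple x ^+ 2; y ^+ 2; z ^+ 2].
  move=> x0 y0; split; last by exists (z ^+ 2); rewrite x0 y0 expr0n.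
  by apply: mod4_of_fval0; rewrite -y0 Fp y0 expr0n /= sub0r.
have two4 : (2 : C) <> 4.
  by move/eqP; rewrite -subr_eq0 (_ : 2 - 4 = - 2) ?oppr_eq0 ?pnatr_eq0 //; ring.
case/Y_sub => [h|[/nl_closure_eqs /= [h0 h2]|[[z' [/eqP hx /eqP hy _]]|[/= /eqP hx /eqP hz]]]].
- have [x' [z' [[/= h1 h2 h3] hx hz]]] := square_curve_char h (erefl (y ^+ 2)).
  rewrite /= in hx hz.
  rewrite Fp F0 Fs !mul1r in h1 h2 h3.
  have x'z' : x' * z' = 0 by rewrite h2 subrr.
  have z'y : z' * y = 0 by move/eqP: h1; rewrite mulr1 -subr_eq0 addrAC subrr add0r oppr_eq0 => /eqP.
  case: two4; have [z'0|z'0] := eqVneq z' 0.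
    have z0 : z = 0 by move/eqP: hz; rewrite z'0 expr0n eq_sym expf_eq0 /= => /eqP.
    move: k0; rewrite /kappa z0 -hx h3 => k0.
    by apply/eqP; rewrite -subr_eq0 -k0; apply/eqP; ring.
  have y0 : y = 0 by move/eqP: z'y; rewrite mulf_eq0 (negbTE z'0) => /eqP.
  have x0 : x' = 0 by move/eqP: x'z'; rewrite mulf_eq0 (negbTE z'0) orbF => /eqP.
  move: h3; rewrite x0 y0 => h3.
  have e2 : (2 : C) = 0 by transitivity (1 - (0 ^+ 2 - 1) : C); [ring|rewrite -h3 expr0n].
  have -> : 4 = 2 + 2 :> C by ring.
  by rewrite e2 addr0.
- rewrite q1_sqr Fp subrK in h0; rewrite q3_sqr q2_sqr Fp F0 subrK in h2.
  have [y0|y0] := eqVneq y 0.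
    right; apply: axis => //; move/eqP: h0; rewrite y0 expr0n expf_eq0 /=.
    by move/eqP.
  left; exists (y ^+ 2); rewrite ?q1_sqr ?q2_sqr ?q3_sqr Fp subrK ?expf_neq0 // F0 h0.
  by rewrite -h2 mulfK // expf_neq0.
- by right; apply: axis; apply/eqP; [move: hx|move: hy]; rewrite expf_eq0.
- move: hx hz; rewrite !expf_eq0 /= => /eqP x0 /eqP z0.
  case/eqP: b21; apply: sqr_trace_sub4 => //; rewrite -yE.
  move: k0; rewrite /kappa x0 z0 => k0.
  by apply/eqP; rewrite -subr_eq0 -k0; apply/eqP; ring.
Qed.

Lemma nonlifting_mem (x y z : C) : char_eqs n (-1) x y z ->
  Y_ n [tuple x ^+ 2; y ^+ 2; z ^+ 2] -> Y_nonlifting n [tuple x ^+ 2; y ^+ 2; z ^+ 2].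
Proof.
move=> /(char_point _) [|A [B [dA dB rel _ [tA tB tAB]]] Yp].
  by rewrite sqrrN expr1n.
split=> //; exists A, B.
have [h nl] : psl_rep n A B /\ ~ liftable n A B by apply/nonliftableE.
by rewrite /psl_char tA tB tAB.
Qed.

Lemma Y_nonliftingE : Y_nonlifting n =
  nl_points1 n `|` nl_points2 n `|` N `|` [set p | (n %% 4)%Z = 0 /\ z_axis p].
Proof.
have sq1 : (-1 : C) ^+ 2 = 1 by rewrite sqrrN expr1n.
have NY : N `<=` Y_nonlifting n.
  move=> _ [y y0 ->]; have := nl_closure_sub (sub_zclosure (ex_intro2 _ _ y y0 erefl)).
  by have [x [y' [z [eqs ->]]]] := nl_curve_char y0; apply: nonlifting_mem.
apply/seteqP; split => [p [Yp [A [B [psl nl pE]]]]|p [[[|]|]|]].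
- have [dA dB rel] : [/\ \det A = 1, \det B = 1 & B ^ (- n) = -1 *: rel_word A B].
    exact/nonliftableE.
  have [irr|nirr] := pselect (irreducible_rep A B).
    have := neg_char_cases (char_eqs_irreducible dA dB sq1 irr rel); rewrite -/(psl_char A B) -pE.
    by case=> h; [left; right|left; left; right|right].
  rewrite pE in Yp *; case: (reducible_nonlifting dA dB rel nirr Yp) => h.
    by left; right.
  by right.
- by move=> /nl_points1_sub /NY.
- move=> /nl_points2P [y [eqs y4] ->].
  have -> : [tuple 0; y ^+ 2; 0] = [tuple 0 ^+ 2; y ^+ 2; 0 ^+ 2] :> pt C 3 by rewrite !expr0n.
  apply: nonlifting_mem => //; apply: psl_char_mem => //.
  by rewrite /kappa !mul0r !expr0n /= addr0 subr0 add0r subr_eq0.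
- exact: NY.
- move=> [n4 zp]; have Yp := z_axis_sub_Y n4 zp; case: zp Yp => z ->.
  have -> : [tuple 0; 0; z] = [tuple 0 ^+ 2; 0 ^+ 2; sqrtC z ^+ 2] :> pt C 3.
    by rewrite sqrtCK !expr0n.
  by apply: nonlifting_mem; apply: z_axis_neg_char.
Qed.

(** Faithfulness excludes the two lines; the closure of the non-lifting curve remains. An
    irreducible character on it satisfies x^2 = 1 + f_{n-1} and, since it lifts, x^2 = 1 - f_{n-1},
    so x^2 = 1. For a reducible one, b^2 different from 1 leads to [kappa] = -2, and b^2 = 1 leads
    to n = -1. *)
Lemma canonical_psl_component (Y0 : set (pt C 3)) (A B : 'M[C]_2) :
  is_component (Y_ n) Y0 -> psl_discrete_faithful n A B -> liftable n A B ->
  Y0 (psl_char A B) -> Y0 = square_curve.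
Proof.
move=> hY df /(liftableE n_even) [dA dB rel] YAB.
apply: (component_eq hY square_curve_variety square_curve_sub).
have [x0 x1] := psl_faithful_trace dA df.
have [[_ [_ irr]] sub _] := hY.
have zc := z_axis_variety.1; have sc := square_curve_variety.1; have xzc := xz_zero_closed.
have nc : zclosed (zclosure N) by apply: zclosure_closed.
have axes : ~ (@z_axis C `|` xz_zero) (psl_char A B).
  by case=> [[z /(congr1 (fun p : pt C 3 => p`_0)) /= /eqP]|[/= /eqP]]; rewrite (negbTE x0).
have [|||//|h] := irr square_curve (zclosure N `|` (@z_axis C `|` xz_zero)).
- exact: sc.
- by apply: zclosedU => //; apply: zclosedU.
- by move=> p /sub /Y_sub.
case: (h _ YAB) => // /nl_closure_eqs /= [].
rewrite q1_sqr q3_sqr q2_sqr.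
have rel1 : B ^ (- n) = 1 *: rel_word A B by rewrite scale1r.
have [irrAB|nirr] := pselect (irreducible_rep A B).
  have [_ _ h3] := char_eqs_irreducible dA dB (expr1n _ 2) irrAB rel1.
  move=> h4 _; case/eqP: x1; rewrite mul1r in h3.
  have : 2 * \tr A ^+ 2 = 2 by rewrite mulr2n mulrDl mul1r {1}h3 h4; ring.
  have two0 : (2 : C) != 0 by rewrite pnatr_eq0.
  by move=> E; apply: (mulfI two0); rewrite E mulr1.
have [a [b [eig /(_ _ rel1) bn]]] := reducible_eigen_pair n dA dB nirr.
have k0 := eigen_pair_kappa eig; have [a0 b0 [_ yE _]] := eig.
move: x0 {x1 axes h YAB df rel rel1 nirr eig}.
move: (\tr A) (\tr B) (\tr (A * B)) yE k0 => x y z yE k0 x0 h0 h2.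
have [b2|b2] := eqVneq (b ^+ 2) 1; last first.
  have [Fp F0 Fs] := reducible_fvals b0 (expr1n _ 2) bn b2; rewrite -yE in Fp F0 Fs.
  rewrite Fp F0 in h0 h2.
  have z0 : z = 0.
    have : z ^+ 2 * x ^+ 2 = 0 by rewrite h0 h2; ring.
    by move/eqP; rewrite mulf_eq0 (negbTE x0) orbF expf_eq0 /= => /eqP.
  move: k0; rewrite /kappa z0 h0 => /eqP.
  have -> : 1 * (1 - y ^+ 2) + 1 + y ^+ 2 + 0 ^+ 2 - x * y * 0 - 4 = - 2 by ring.
  by rewrite oppr_eq0 pnatr_eq0.
have bi : b^-1 = b by apply: (mulfI b0); rewrite divff // -expr2.
have y2 : y ^+ 2 = 2 ^+ 2.
  by rewrite yE bi; transitivity (4 * b ^+ 2); [ring|rewrite b2; ring].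
rewrite -q1_sqr in h0; rewrite -q3_sqr -q2_sqr in h2.
have [q14 q24 q34] := q_at4.
rewrite y2 (_ : 2 ^+ 2 = 4 :> C) in h0 h2; last by ring.
rewrite q14 in h0; rewrite q34 q24 in h2.
have zx : z ^+ 2 = x ^+ 2.
  have [c c2 yc] := sqr_eq_sign y2.
  (* For y = 2 c with c^2 = 1, [kappa] is the square (x - c z)^2. *)
  have : (x - c * z) ^+ 2 = 0.
    rewrite -k0 /kappa yc.
    transitivity (x ^+ 2 + c ^+ 2 * z ^+ 2 - 2 * c * x * z); first by ring.
    transitivity (x ^+ 2 + c ^+ 2 * 4 + z ^+ 2 - 2 * c * x * z - 4); last by ring.
    by rewrite c2; ring.
  by move/eqP; rewrite expf_eq0 /= subr_eq0 => /eqP ->; rewrite exprMn c2 mul1r.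
move: h2; rewrite zx h0 => /eqP; rewrite -subr_eq0.
have -> : n%:~R * n%:~R - (n%:~R + 2) ^+ 2 = - (4 * (n + 1)%:~R) :> C.
  by rewrite rmorphD /=; ring.
rewrite oppr_eq0 mulf_eq0 pnatr_eq0 intr_eq0 /= => /eqP n1.
by move: n_gt2; have -> : n = -1 by lia.
Qed.

Lemma nl_closure_component : is_component (Y_ n) (zclosure N).
Proof.
have zc := z_axis_variety.1; have sc := square_curve_variety.1.
apply: (@is_componentI _ _ _ _ (square_curve `|` (@z_axis C `|` xz_zero)) nl_closure_variety
  nl_closure_sub).
- by apply: zclosedU => //; apply: zclosedU xz_zero_closed.
- by move=> p /Y_sub [|[|]]; [right; left|left|right; right].
have [p Np [p0 p1 _]] := nl_curve_at4; move=> /(_ p (sub_zclosure Np)).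
have n0 := n_neq0.
case=> [h|[[z /(congr1 (fun p : pt C 3 => p`_0)) /= /eqP]|[/= /eqP]]];
  rewrite ?p0 ?(negbTE n0) //.
have y2 : 2 ^+ 2 = p`_1 by rewrite p1; ring.
have [x [z [[_ _ h3] hx _]]] := square_curve_char h y2.
(* At y = 2 the non-lifting curve has x^2 = n and the main curve x^2 = 1 - (n - 1), which agree only
   for n = 1. *)
move: h3; rewrite hx p0 fval2C mul1r => /eqP; rewrite -subr_eq0.
have -> : n%:~R - (1 - (n - 1)%:~R) = 2 * (n - 1)%:~R :> C by rewrite rmorphB /=; ring.
rewrite mulf_eq0 pnatr_eq0 intr_eq0 /= => /eqP /subr0_eq n1.
by move: n_gt2; rewrite n1.
Qed.

(* The curve satisfies [zb f_m(y) = (2 f_m - y f_{m-1})(y f_m - f_{m-1})^2]; for m even both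
   sides are divisible by [y], and after division a single point of the z-axis is left. *)
Lemma z_axis_not_nl : (n %% 4)%Z = 0 -> ~ @z_axis C `<=` zclosure N.
Proof.
move=> n4 h; have [j mE] : exists j, m = j * 2.
  by case: half_parity => [[_ //]|[e2 _]]; rewrite e2 in n4.
have [w wE] : exists w : {poly C}, forall y, v y = w.[y] * y.
  have /factor_theorem [w wE] : root (fpoly C m) 0 by rewrite rootE v0_even.
  by exists w => y; rewrite wE hornerM !hornerE subr0.
have u_even y : u (- y) = u y.
  by rewrite mE (_ : j * 2 - 1 = (j - 1) * 2 + 1); [rewrite fval_opp_odd|ring].
have w_even y : w.[- y] = w.[y].
  have [->|y0] := eqVneq y 0; first by rewrite oppr0.
  apply: (mulIf y0); apply: oppr_inj; rewrite -mulrN -!wE mE.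
  by rewrite fval_opp_even.
have [|wb wbE] := @even_poly_sqr C w; first exact: w_even.
pose r := (2%:P * w - fpoly C (m - 1)) * ('X * fpoly C m - fpoly C (m - 1)) ^+ 2.
have rE y : r.[y] = (2 * w.[y] - u y) * (y * v y - u y) ^+ 2.
  by rewrite hornerM horner_exp !hornerD !hornerN !hornerM hornerC hornerX.
have [|rb rbE] := @even_poly_sqr C r.
  by move=> y; rewrite !rE w_even u_even wE w_even wE mulrN mulrNN.
have pc := @polyfun_coord C 3; have ph q := polyfun_horner q (pc 1%N).
have key z : z * wb.[0] = rb.[0].
  have : zclosure N [tuple 0; 0; z] by apply: h; exists z.
  apply: (@zclosure_min C 3 N [set p : pt C 3 | p`_2 * wb.[p`_1] = rb.[p`_1]]).
    by apply: zclosed_eq => //; apply: polyfunM.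
  move=> _ [yb q0 ->] /=; move: q0.
  have -> : yb = sqrtC yb ^+ 2 by rewrite sqrtCK.
  move: (sqrtC yb) => y; rewrite q3_sqr q2_sqr wbE rbE rE fval_npred fval_n.
  have q := uv_quad y; have vE := wE y.
  move: (u y) (v y) (w.[y]) q vE => a b c q vE.
  have -> : b ^+ 2 - a ^+ 2 + 1 = b * (2 * b - y * a) by rewrite -[in LHS]q; ring.
  have -> : y + (y * b ^+ 2 - 2 * a * b) = (2 * b - y * a) * (y * b - a).
    apply/eqP; rewrite -subr_eq0; apply/eqP.
    by transitivity (y * (1 - (a ^+ 2 + b ^+ 2 - y * a * b))); [ring|rewrite q subrr mulr0].
  rewrite mulf_eq0 negb_or => /andP [b0 d0].
  have [c0 y0] : c != 0 /\ y != 0 by apply/andP; rewrite -negb_or -mulf_eq0 -vE.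
  have d1 : 2 * b - y * a = y * (2 * c - a) by rewrite vE; ring.
  transitivity ((y * (2 * c - a)) ^+ 2 * (y * b - a) ^+ 2 / (c * y * (y * (2 * c - a))) * c).
    by rewrite -d1 -vE; field; rewrite b0 d0.
  have d2 : 2 * c - a != 0 by move: d0; rewrite d1 mulf_eq0 negb_or => /andP [].
  by field; rewrite c0 y0 d2.
(* The relation at y = 0 holds for z = 0 and z = 1, so both its coefficients vanish. This leaves
   f_{m-1}(0)^3 = 0, against f_{m-1}(0)^2 = 1. *)
have r0 : r.[0] = 0 by rewrite -rbE expr0n -(key 0) mul0r.
have w0 : w.[0] = 0 by rewrite -wbE expr0n /= -[LHS]mul1r key -(key 0) mul0r.
have := uv_quad 0; rewrite (v0_even n4) => q.
have u2 : u 0 ^+ 2 = 1 by rewrite -q; ring.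
move: r0; rewrite rE w0 => r0.
have : u 0 * u 0 ^+ 2 = - ((2 * 0 - u 0) * (0 * v 0 - u 0) ^+ 2) by ring.
rewrite r0 oppr0 u2 mulr1 => u0.
by move/eqP: u2; rewrite u0 expr0n eq_sym oner_eq0.
Qed.

Lemma z_axis_component_Y : (n %% 4)%Z = 0 -> is_component (Y_ n) (@z_axis C).
Proof.
move=> n4; have [zc [zn zirr]] := z_axis_variety.
have sc := square_curve_variety.1; have nc := @zclosure_closed C 3 N.
apply: (@is_componentI _ _ _ _ (square_curve `|` (zclosure N `|` xz_zero)) z_axis_variety
  (z_axis_sub_Y n4)).
- by apply: zclosedU => //; apply: zclosedU xz_zero_closed.
- by move=> p /Y_sub [|[|[|]]]; [right; left|right; right; left|left|right; right; right].
move=> h.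
have [|//|h1|h1] := zirr square_curve (zclosure N `|` xz_zero) sc.
- by apply: zclosedU xz_zero_closed.
(* At the origin the two signs of the equations require f_{n-1}(0) = 1 and f_{n-1}(0) = -1. *)
- have zz : square_curve [tuple 0; 0; 0] by apply: h1; exists 0.
  have [x [z [[_ _ h3] hx _]]] := square_curve_char zz (expr0n C 2).
  have [_ _ /eqP] := z_axis_neg_char 0 n4.
  rewrite expr0n mulN1r opprK eq_sym addrC addr_eq0 => /eqP Fp.
  move: h3; rewrite hx Fp mul1r opprK => /eqP.
  by rewrite eq_sym -mulr2n pnatr_eq0.
have [|/(z_axis_not_nl n4)//|h2] := zirr _ _ nc xz_zero_closed.
  exact: h1.
have [_ /= /eqP] : xz_zero [tuple 0; 0; 1] by apply: h2; exists 1.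
by rewrite oner_eq0.
Qed.

Lemma z_axis_isomorphic : zisomorphic (@z_axis C) (@affine_line C).
Proof.
have [f hf] := @polyfun_coord C 3 2; have [g hg] := @polyfun_coord C 1 0.
have [c hc] := polyfun_cst 1 (0 : C).
have fE p : polymap [tuple f] p = [tuple p`_2] :> pt C 1.
  by apply/val_inj; rewrite /= hf.
have gE q : polymap [tuple c; c; g] q = [tuple 0; 0; q`_0] :> pt C 3.
  by apply/val_inj; rewrite /= hc hg.
exists [tuple f], [tuple c; c; g]; split=> //.
- by move=> q _; rewrite gE; exists q`_0.
- by move=> _ [z ->]; rewrite fE gE.
- by move=> q _; rewrite gE fE /=; apply/val_inj; case: q => -[|x []].
Qed.

End CanonicalComponent.

Theorem theorem7p7 (R : realType) (n : int)
  (n_even : (2 %| n)%Z) (n_gt2 : 2 < `|n|)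
  (hh lh q1 q2 q3 : {poly R[i]})
  (hhE : is_hat n (hpoly R[i] n) hh) (lhE : is_hat n (lpoly R[i] n) lh)
  (q1E : q1 \Po 'X^2 = fpoly R[i] (n - 1) + 1)
  (q2E : q2 \Po 'X^2 = (fpoly R[i] n + 'X) ^+ 2)
  (q3E : q3 \Po 'X^2 = fpoly R[i] (n - 1) + 1)
  (X0 Y0 : set (pt R[i] 3))
  (X0_component : is_component (X_ n) X0)
  (X0_canonical : exists A B : 'M[R[i]]_2,
     [/\ sl_rep n A B, sl_discrete_faithful n A B & X0 (sl_char A B)])
  (Y0_component : is_component (Y_ n) Y0)
  (Y0_canonical : exists A B : 'M[R[i]]_2,
     [/\ psl_rep n A B, psl_discrete_faithful n A B, liftable n A B
       & Y0 (psl_char A B)]) :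
  [/\ is_mu2_quotient n X0 Y0
      /\ (exists phi : ratmap R[i] 3 2,
            [/\ birational_map phi X0 (Fcurve hh lh),
                forall r, Fcurve hh lh r ->
                  Fcurve hh lh (F_hyp r) /\ Fcurve hh lh (F_neg r)
              & forall p q, rdom phi X0 p -> rdom phi X0 q ->
                  (mu2_orbit n p q
                   <-> F_identified (reval phi p) (reval phi q))]),
      birational Y0 (@affine_line R[i]),
      (n %% 4)%Z = 2 ->
        is_component (X_ n) (@z_axis R[i])
        /\ (exists j : pt R[i] 3 -> pt R[i] 3,
              [/\ forall p, z_axis p -> z_axis (j p),
                  forall p, z_axis p -> j (j p) = p,
                  exists2 p, z_axis p & j p <> p
                & forall p q, z_axis p -> z_axis q ->
                    (mu2_orbit n p q <-> q = p \/ q = j p)]),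
      Y_nonlifting n =
        nl_points1 n `|` nl_points2 n `|` nl_curve q1 q2 q3
        `|` [set p | (n %% 4)%Z = 0 /\ z_axis p]
    & [/\ is_component (Y_ n) (zclosure (nl_curve q1 q2 q3)),
          birational (zclosure (nl_curve q1 q2 q3)) (@affine_line R[i]),
          (n %% 4)%Z = 0 -> is_component (Y_ n) (@z_axis R[i])
        & (n %% 4)%Z = 0 -> zisomorphic (@z_axis R[i]) (@affine_line R[i])]].

Proof.
have [A [B [rel df XAB]]] := X0_canonical.
have X0E := canonical_component_eq n_even n_gt2 hhE lhE X0_component rel df XAB.
have [A' [B' [_ df' lft YAB]]] := Y0_canonical.
have Y0E := canonical_psl_component n_even n_gt2 hhE lhE q1E q2E q3E Y0_component df' lft YAB.
rewrite X0E Y0E; split.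
- split; first exact: main_mu2_quotient.
  exact: Fcurve_birational.
- exact: square_curve_birational.
- move=> n4; split; first exact: (z_axis_component n_even n_gt2 hhE lhE).
  exact: (z_axis_involution _ n_even n4).
- exact: (Y_nonliftingE n_even n_gt2 hhE lhE).
- split.
  + exact: (nl_closure_component n_even n_gt2 hhE lhE).
  + exact: (nl_closure_birational n_gt2 q1E q2E q3E).
  + exact: (z_axis_component_Y n_even n_gt2 hhE lhE q1E q2E q3E).
  + by move=> _; apply: z_axis_isomorphic.
Qed.
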